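(* A shift space $X$ is the natural coding of a regular $3$-interval exchange transformation if and only if there exist a permutation $\pi_0\in\Sigma_3$, a sequence $(\sigma_n)_{n\ge1}$ of morphisms in $\Sigma_3\mathcal{S}_3\Sigma_3$ and a sequence $(v_n)_{n\ge1}$ of vertices of the graph $\mathcal{G}_{\mathrm{IET}}$ described below such that for every $n$, $\sigma_n$ labels an edge of $\mathcal{G}_{\mathrm{IET}}$ from $v_n$ to $v_{n+1}$, and the directive sequence $(\pi_0,\sigma_1,\sigma_2,\dots)$ is primitive and is an $\mathcal{S}$-adic representation of $X$.
   Context: Interval exchange transformations: let $I=[l,r)$, $\lambda=(\lambda_1,\dots,\lambda_d)$ positive with $\sum\lambda_i=r-l$, and $\pi_0,\pi_1$ permutations of $\{1,\dots,d\}$. Set $\mu_0=l$, $\mu_i=l+\sum_{\pi_0^{-1}(j)\le i}\lambda_j$, $\nu_0=l$, $\nu_i=l+\sum_{\pi_1^{-1}(j)\le i}\lambda_j$, $I_{\pi_0(i)}=[\mu_{i-1},\mu_i)$, $J_{\pi_1(i)}=[\nu_{i-1},\nu_i)$. The IET $T=T_{\lambda,\pi_0,\pi_1}:I\to I$ is the piecewise translation mapping $I_i$ onto $J_i$ for each $i$. It is regular if the orbits $\{T^n(\mu_i):n\in\mathbb{Z}\}$, $1\le i<d$, are infinite and pairwise disjoint. A word $b_0\cdots b_{m-1}$ over $\{1,\dots,d\}$ is admissible if $I_{b_0}\cap T^{-1}(I_{b_1})\cap\cdots\cap T^{-m+1}(I_{b_{m-1}})\ne\emptyset$; the natural coding of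 $T$ is $X_T=\{x\in\{1,\dots,d\}^{\mathbb{Z}}:\text{all factors of }x\text{ are admissible}\}$. A $3$-IET is one with $d=3$. Shift spaces, morphisms (non-erasing), directive sequences: $\boldsymbol\sigma=(\sigma_n)$ is primitive if for each $n$ there is $N>n$ such that all letters occur in every $\sigma_n\cdots\sigma_{N-1}(b)$; a primitive $\boldsymbol\sigma$ is a representation of the shift $X_{\boldsymbol\sigma}$ of bi-infinite words all of whose factors occur in some $\sigma_1\cdots\sigma_{N-1}(a)$. $\pi_{abc}$ is the morphism $1\mapsto a,2\mapsto b,3\mapsto c$ ($\{a,b,c\}=\{1,2,3\}$), $\Sigma_3$ the set of these; juxtaposition is composition. $\mathcal{S}_3=\{\alpha,\beta,\gamma,\eta\}\cup\{\delta^{(k)},\zeta^{(k)}:k\ge1\}$ with $\alpha:1\mapsto1,2\mapsto12,3\mapsto13$; $\beta:1\mapsto1,2\mapsto12,3\mapsto132$; $\gamma:1\mapsto1,2\mapsto12,3\mapsto123$; $\delta^{(k)}:1\mapsto1,2\mapsto123^k,3\mapsto123^{k+1}$; $\zeta^{(k)}:1\mapsto13^k,2\mapsto12,3\mapsto13^{k+1}$; $\eta:1\mapsto13,2\mapsto12,3\mapsto123$. The graph $\mathcal{G}_{\mathrm{IET}}$ has vertices $[3,2]$ and $[3,3]$ (each with entering edges labeled by every permutation, corresponding to $\pi_0$), and edges ($k\ge1$): loops at $[3,2]$ labeled $\alpha$ and $\pi_{132}\eta\pi_{321}$; loops at $[3,3]$ labeled $\alpha$, $\pi_{213}\alpha\pi_{213}$,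 $\zeta^{(k)}\pi_{213}$, $\pi_{213}\zeta^{(k)}\pi_{213}$; edges from $[3,2]$ to $[3,3]$ labeled $\pi_{312}\beta\pi_{213}$, $\pi_{213}\gamma$, $\pi_{213}\delta^{(k)}$. There are no edges from $[3,3]$ to $[3,2]$. *)

(* Defs.v *)
From Stdlib Require Import Reals ZArith List.
From mathcomp Require Import all_boot all_fingroup.

Set Implicit Arguments.
Unset Strict Implicit.
Unset Printing Implicit Defensive.

Definition Rleb (x y : R) : bool := if Rle_dec x y then true else false.
Definition Rltb (x y : R) : bool := if Rlt_dec x y then true else false.

Definition Rsum {d : nat} (P : pred 'I_d) (f : 'I_d -> R) : R :=
  fold_right Rplus R0 (map f (filter P (enum 'I_d))).

(* Interval exchange transformations on the alphabet 'I_d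
   (letter k : 'I_d stands for the letter k+1 of the paper).          *)
Section IET.
Variables (d : nat) (l r : R) (lam : 'I_d -> R) (p0 p1 : {perm 'I_d}).

(* 0-based position of letter a in the ordering given by p
   (p maps positions to letters, so the position is p^-1 a). *)
Definition pos (p : {perm 'I_d}) (a : 'I_d) : nat := (p^-1)%g a.

Definition left_end (p : {perm 'I_d}) (a : 'I_d) : R :=
  Rplus l (Rsum (fun j => (pos p j < pos p a)%N) lam).

(* mu_i = l + sum_{pi0^{-1}(j) <= i} lambda_j  (1-based positions) *)
Definition mu (i : nat) : R := Rplus l (Rsum (fun j => (pos p0 j < i)%N) lam).

Definition inIb (a : 'I_d) (x : R) : bool :=
  Rleb (left_end p0 a) x && Rltb x (Rplus (left_end p0 a) (lam a)).
Definition inJb (a : 'I_d) (x : R) : bool :=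
  Rleb (left_end p1 a) x && Rltb x (Rplus (left_end p1 a) (lam a)).

(* T maps I_a onto J_a by translation (identity outside [l,r)). *)
Definition T (x : R) : R :=
  match [pick a | inIb a x] with
  | Some a => Rplus (Rminus x (left_end p0 a)) (left_end p1 a)
  | None => x
  end.
Definition Tinv (x : R) : R :=
  match [pick a | inJb a x] with
  | Some a => Rplus (Rminus x (left_end p1 a)) (left_end p0 a)
  | None => x
  end.

Definition Tpow (n : Z) (x : R) : R :=
  match n with
  | Z0 => x
  | Zpos k => iter (Pos.to_nat k) T x
  | Zneg k => iter (Pos.to_nat k) Tinv x
  end.

Definition orbit (x : R) : R -> Prop := fun y => exists n : Z, Tpow n x = y.

Definition finite_set (S : R -> Prop) : Prop :=
  exists s : list R, forall y, S y -> In y s.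

Definition regular : Prop :=
  (forall i, (1 <= i < d)%N -> ~ finite_set (orbit (mu i))) /\
  (forall i j, (1 <= i)%N -> (i < j)%N -> (j < d)%N ->
     forall y, orbit (mu i) y -> ~ orbit (mu j) y).

Fixpoint adm_from (x : R) (w : seq 'I_d) : Prop :=
  match w with
  | [::] => True
  | b :: w' => inIb b x /\ adm_from (T x) w'
  end.

Definition admissible (w : seq 'I_d) : Prop :=
  exists x : R, Rle l x /\ Rlt x r /\ adm_from x w.

End IET.

Definition factor {A : Type} (x : Z -> A) (i : Z) (m : nat) : seq A :=
  map (fun k => x (i + Z.of_nat k)%Z) (iota 0 m).

Definition shift_space {A : Type} (X : (Z -> A) -> Prop) : Prop :=
  (forall x, X x -> X (fun i => x (i + 1)%Z)) /\
  (forall x, X x -> X (fun i => x (i - 1)%Z)) /\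
  (* closed in the product topology *)
  (forall x, (forall i m, exists y, X y /\ factor y i m = factor x i m) -> X x).

Definition natural_coding d l r lam p0 p1 : (Z -> 'I_d) -> Prop :=
  fun x => forall (i : Z) (m : nat), admissible l r lam p0 p1 (factor x i m).

Definition is_natural_coding_regular_IET (d : nat) (X : (Z -> 'I_d) -> Prop) : Prop :=
  exists (l r : R) (lam : 'I_d -> R) (p0 p1 : {perm 'I_d}),
    (forall a, Rlt R0 (lam a)) /\
    Rsum predT lam = Rminus r l /\
    regular l lam p0 p1 /\
    (forall x, X x <-> natural_coding l r lam p0 p1 x).

Definition l1 : 'I_3 := @Ordinal 3 0 isT.
Definition l2 : 'I_3 := @Ordinal 3 1 isT.
Definition l3 : 'I_3 := @Ordinal 3 2 isT.

Definition morph := 'I_3 -> seq 'I_3.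
Definition meq (f g : morph) : Prop := forall a, f a = g a.
Definition comp (f g : morph) : morph := fun a => flatten (map f (g a)).
Definition idm : morph := fun a => [:: a].

Definition mk3 (u1 u2 u3 : seq 'I_3) : morph :=
  fun a => if a == l1 then u1 else if a == l2 then u2 else u3.

Definition pim (a b c : 'I_3) : morph := mk3 [:: a] [:: b] [:: c].
Definition pi132 := pim l1 l3 l2.
Definition pi213 := pim l2 l1 l3.
Definition pi312 := pim l3 l1 l2.
Definition pi321 := pim l3 l2 l1.
Definition perm_morph (p : {perm 'I_3}) : morph := fun a => [:: p a].
Definition in_Sigma3 (f : morph) : Prop := exists p : {perm 'I_3}, meq f (perm_morph p).

Definition alpha : morph := mk3 [:: l1] [:: l1; l2] [:: l1; l3].
Definition beta  : morph := mk3 [:: l1] [:: l1; l2] [:: l1; l3; l2].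
Definition gamma : morph := mk3 [:: l1] [:: l1; l2] [:: l1; l2; l3].
Definition delta (k : nat) : morph :=
  mk3 [:: l1] ([:: l1; l2] ++ nseq k l3) ([:: l1; l2] ++ nseq k.+1 l3).
Definition zeta (k : nat) : morph :=
  mk3 (l1 :: nseq k l3) [:: l1; l2] (l1 :: nseq k.+1 l3).
Definition eta : morph := mk3 [:: l1; l3] [:: l1; l2] [:: l1; l2; l3].

Definition in_S3 (f : morph) : Prop :=
  meq f alpha \/ meq f beta \/ meq f gamma \/ meq f eta \/
  (exists k, (1 <= k)%N /\ (meq f (delta k) \/ meq f (zeta k))).

Definition in_Sigma3_S3_Sigma3 (f : morph) : Prop :=
  exists p s q, in_Sigma3 p /\ in_S3 s /\ in_Sigma3 q /\ meq f (comp p (comp s q)).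

Inductive vertex := V32 | V33.

Definition edge (v w : vertex) (f : morph) : Prop :=
  match v, w with
  | V32, V32 => meq f alpha \/ meq f (comp pi132 (comp eta pi321))
  | V33, V33 => meq f alpha \/ meq f (comp pi213 (comp alpha pi213)) \/
      (exists k, (1 <= k)%N /\
         (meq f (comp (zeta k) pi213) \/ meq f (comp pi213 (comp (zeta k) pi213))))
  | V32, V33 => meq f (comp pi312 (comp beta pi213)) \/ meq f (comp pi213 gamma) \/
      (exists k, (1 <= k)%N /\ meq f (comp pi213 (delta k)))
  | V33, V32 => False
  end.

Fixpoint prodm (tau : nat -> morph) (n k : nat) : morph :=
  match k with
  | 0 => idm
  | k'.+1 => comp (tau n) (prodm tau n.+1 k')
  end.

Definition primitive_dir (tau : nat -> morph) : Prop :=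
  forall n, exists N, (n < N)%N /\
    forall b c : 'I_3, c \in prodm tau n (N - n) b.

Definition S_adic_shift (tau : nat -> morph) : (Z -> 'I_3) -> Prop :=
  fun x => forall (i : Z) (m : nat),
    exists (N : nat) (a : 'I_3), infix (factor x i m) (prodm tau 0 N a).

(* the directive sequence (pi0, sigma_1, sigma_2, ...);
   sigma n stands for sigma_{n+1} *)
Definition dirseq (p0 : {perm 'I_3}) (sigma : nat -> morph) : nat -> morph :=
  fun n => match n with 0 => perm_morph p0 | n'.+1 => sigma n' end.

(* Main.v *)
Require Import Defs.
From Stdlib Require Import Reals ZArith Lra Classical ClassicalEpsilon FunctionalExtensionality.
From mathcomp Require Import all_boot all_fingroup.
From mathcomp Require Import zify.
From mathcomp Require filter.

(* The first return of a regular exchange of three intervals to the interval I_a of a suitable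
   letter a is again one, and a point of the c-th new interval returns along a word sigma(c). Up to
   renaming letters and reflecting the line, an irreducible exchange has one of two combinatorial
   types, which are the vertices of the graph, and the edges list the possible first returns. An
   equality between the lengths that are compared would give a connection between division points,
   which regularity excludes; hence a regular exchange determines an infinite path. The path is
   primitive, since otherwise some length would stay constant while being subtracted from the total
   length forever.

   Conversely, primitivity yields positive length vectors compatible with all incidence matrices, so
   a path is the sequence of first returns of an exchange. A connection of this exchange would
   descend along the path to connections with fewer and fewer steps, so it is regular. In both
   directions the nested intervals I_N shrink to length zero, so that an admissible word has an
   occurrence that does not straddle two return words to I_N for some N, and the language is that
   of the directive sequence. *)

Set Implicit Arguments.
Unset Strict Implicit.
Unset Printing Implicit Defensive.

Local Open Scope R_scope.

(** * Interval exchanges of three intervals as abstract systems *)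

Lemma ord3_ind (P : 'I_3 -> Prop) : P l1 -> P l2 -> P l3 -> forall a, P a.
Proof.
move=> P1 P2 P3 [[|[|[|//]]] i].
- by rewrite (_ : Ordinal i = l1) //; apply: val_inj.
- by rewrite (_ : Ordinal i = l2) //; apply: val_inj.
- by rewrite (_ : Ordinal i = l3) //; apply: val_inj.
Qed.

Lemma ord3_enum (o : 'I_3 -> 'I_3) : injective o ->
  forall P : 'I_3 -> Prop, P (o l1) -> P (o l2) -> P (o l3) -> forall a, P a.
Proof.
move=> oI P.
have n12 : o l1 <> o l2 by move/oI.
have n13 : o l1 <> o l3 by move/oI.
have n23 : o l2 <> o l3 by move/oI.
move: n12 n13 n23.
elim/ord3_ind: (o l1); elim/ord3_ind: (o l2); elim/ord3_ind: (o l3) => // *;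
  by apply: ord3_ind.
Qed.

(** The orders [top] and [bot], from positions to letters, are plain functions rather than
    permutations, so that the explicit orders of the vertices compute; [wf] supplies injectivity. *)
Record sys := Sys {
  top : 'I_3 -> 'I_3; bot : 'I_3 -> 'I_3; lft : R; len : 'I_3 -> R }.

Definition lend (l : R) (lam : 'I_3 -> R) (o : 'I_3 -> 'I_3) (a : 'I_3) : R :=
  if a == o l1 then l else if a == o l2 then l + lam (o l1)
  else l + lam (o l1) + lam (o l2).

Definition total (lam : 'I_3 -> R) : R := lam l1 + lam l2 + lam l3.

Definition wf (S : sys) : Prop :=
  [/\ injective (top S), injective (bot S) & forall a, 0 < len S a].

Definition lpt (S : sys) : 'I_3 -> R := lend (lft S) (len S) (top S).
Definition bpt (S : sys) : 'I_3 -> R := lend (lft S) (len S) (bot S).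
Definition tr (S : sys) (a : 'I_3) : R := bpt S a - lpt S a.
Definition inT (S : sys) (a : 'I_3) (x : R) : Prop :=
  lpt S a <= x < lpt S a + len S a.
Definition inI (S : sys) (x : R) : Prop := lft S <= x < lft S + total (len S).

(** Birkhoff sum of the translations along an itinerary. *)
Fixpoint sh (S : sys) (w : seq 'I_3) : R :=
  if w is b :: w' then tr S b + sh S w' else 0.

Fixpoint adm (S : sys) (x : R) (w : seq 'I_3) : Prop :=
  if w is b :: w' then inT S b x /\ adm S (x + tr S b) w' else True.

Lemma total_order (o : 'I_3 -> 'I_3) lam : injective o ->
  total lam = lam (o l1) + lam (o l2) + lam (o l3).
Proof.
move=> oI; rewrite /total.
have n12 : o l1 <> o l2 by move/oI.
have n13 : o l1 <> o l3 by move/oI.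
have n23 : o l2 <> o l3 by move/oI.
move: n12 n13 n23.
elim/ord3_ind: (o l1); elim/ord3_ind: (o l2); elim/ord3_ind: (o l3) => // *; lra.
Qed.

Section Tiling.
Variables (l : R) (lam : 'I_3 -> R) (o : 'I_3 -> 'I_3).
Hypotheses (oI : injective o) (lam_gt0 : forall a, 0 < lam a).

Lemma lend1 : lend l lam o (o l1) = l.
Proof. by rewrite /lend eqxx. Qed.
Lemma lend2 : lend l lam o (o l2) = l + lam (o l1).
Proof. by rewrite /lend (inj_eq oI) eqxx. Qed.
Lemma lend3 : lend l lam o (o l3) = l + lam (o l1) + lam (o l2).
Proof. by rewrite /lend !(inj_eq oI). Qed.

Lemma tile_cover x : l <= x < l + total lam ->
  exists a, lend l lam o a <= x < lend l lam o a + lam a.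
Proof.
rewrite (total_order _ oI) => -[x1 x2].
case: (Rlt_le_dec x (l + lam (o l1))) => [x3|x3].
  by exists (o l1); rewrite lend1; lra.
case: (Rlt_le_dec x (l + lam (o l1) + lam (o l2))) => [x4|x4].
  by exists (o l2); rewrite lend2; lra.
by exists (o l3); rewrite lend3; lra.
Qed.

Lemma tile_sub a x : lend l lam o a <= x < lend l lam o a + lam a ->
  l <= x < l + total lam.
Proof.
rewrite (total_order _ oI).
have := (lam_gt0 (o l1), lam_gt0 (o l2), lam_gt0 (o l3)) => -[[]] ? ? ?.
by elim/(ord3_enum oI): a; rewrite ?lend1 ?lend2 ?lend3; lra.
Qed.

Lemma tile_uniq a b x : lend l lam o a <= x < lend l lam o a + lam a ->
  lend l lam o b <= x < lend l lam o b + lam b -> a = b.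
Proof.
have := (lam_gt0 (o l1), lam_gt0 (o l2), lam_gt0 (o l3)) => -[[]] ? ? ?.
by elim/(ord3_enum oI): a; elim/(ord3_enum oI): b;
  rewrite ?lend1 ?lend2 ?lend3 //; lra.
Qed.

Lemma lend_gt a : a <> o l1 -> l < lend l lam o a.
Proof.
have := (lam_gt0 (o l1), lam_gt0 (o l2), lam_gt0 (o l3)) => -[[]] ? ? ?.
by elim/(ord3_enum oI): a; rewrite ?lend1 ?lend2 ?lend3 //; lra.
Qed.

End Tiling.

Section Exchange.
Variable S : sys.
Hypothesis wfS : wf S.

Let tI : injective (top S). Proof. by case: wfS. Qed.
Let bI : injective (bot S). Proof. by case: wfS. Qed.
Let len_gt0 a : 0 < len S a. Proof. by case: wfS. Qed.

Lemma inI_cover x : inI S x -> exists a, inT S a x.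
Proof. exact: tile_cover. Qed.

Lemma inT_inI a x : inT S a x -> inI S x.
Proof. exact: tile_sub. Qed.

Lemma inT_uniq a b x : inT S a x -> inT S b x -> a = b.
Proof. exact: tile_uniq. Qed.

Lemma lpt_in a : inT S a (lpt S a).
Proof. by move: (len_gt0 a); rewrite /inT; lra. Qed.

Lemma lpt_gt a : a <> top S l1 -> lft S < lpt S a.
Proof. exact: lend_gt. Qed.

Lemma lpt_inj a b : lpt S a = lpt S b -> a = b.
Proof. by move=> e; apply: (@inT_uniq _ _ (lpt S a)); [|rewrite e]; apply: lpt_in. Qed.

Lemma total_len_gt0 : 0 < total (len S).
Proof. by rewrite /total; move: (len_gt0 l1) (len_gt0 l2) (len_gt0 l3); lra. Qed.

Lemma lft_inI : inI S (lft S).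
Proof. by rewrite /inI; move: total_len_gt0; lra. Qed.

Lemma bpt_tr a x : inT S a x -> bpt S a <= x + tr S a < bpt S a + len S a.
Proof. by rewrite /inT /tr; lra. Qed.

Lemma step_inI a x : inT S a x -> inI S (x + tr S a).
Proof. by move/bpt_tr; apply: tile_sub. Qed.

Lemma step_inj a b x y : inT S a x -> inT S b y ->
  x + tr S a = y + tr S b -> a = b /\ x = y.
Proof.
move=> ax bY e.
have ab : a = b.
  by have := bpt_tr ax; rewrite e => h; apply: tile_uniq h (bpt_tr bY).
by split=> //; move: e; rewrite ab; lra.
Qed.

Lemma step_onto y : inI S y -> exists a x, inT S a x /\ y = x + tr S a.
Proof.
move=> Iy; have [a h] := tile_cover bI Iy.
by exists a, (y - tr S a); rewrite /inT; split; move: h; rewrite /tr /bpt; lra.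
Qed.

Lemma sh_cat u v : sh S (u ++ v) = sh S u + sh S v.
Proof. by elim: u => [|a u IH] /=; rewrite ?IH; lra. Qed.

Lemma adm_cat x u v : adm S x (u ++ v) <-> adm S x u /\ adm S (x + sh S u) v.
Proof.
elim: u x => [|a u IH] x /=.
  by rewrite Rplus_0_r; split=> [|[]].
rewrite IH -Rplus_assoc; tauto.
Qed.

Lemma adm_inI x w : inI S x -> adm S x w -> inI S (x + sh S w).
Proof.
elim: w x => [|a w IH] x /= Ix; first by rewrite Rplus_0_r.
by case=> /step_inI h /(IH _ h); rewrite Rplus_assoc.
Qed.

Lemma adm_ex n x : inI S x -> exists2 w, size w = n & adm S x w.
Proof.
elim: n x => [|n IH] x Ix; first by exists [::].
have [a ax] := inI_cover Ix; have [w sw aw] := IH _ (step_inI ax).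
by exists (a :: w); rewrite //= sw.
Qed.

Lemma adm_prefix x u v : adm S x u -> adm S x v -> (size u <= size v)%N ->
  exists v', v = u ++ v'.
Proof.
elim: u x v => [|a u IH] x v; first by exists v.
case: v => [//|b v] /= [ax au] [bx bv] le_uv.
rewrite -(inT_uniq ax bx) in bv *.
by have [v' ->] := IH _ _ au bv le_uv; exists v'.
Qed.

(** The exchange is injective, so the past of a point is as deterministic as its future. *)
Lemma adm_suffix x y u v : adm S x u -> adm S y v -> (size v <= size u)%N ->
  x + sh S u = y + sh S v -> exists u', u = u' ++ v /\ x + sh S u' = y.
Proof.
elim/last_ind: v u => [|v b IH] u ax ay.
  by move=> _; rewrite /= Rplus_0_r => e; exists u; rewrite cats0.
case/lastP: u ax => [|u a] ax; first by rewrite size_rcons.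
move: ax ay; rewrite !size_rcons -!cats1 !sh_cat /=.
move=> /adm_cat[ax [au _]] /adm_cat[ay [bv _]] le_vu e.
have [ab exy] := step_inj au bv ltac:(lra); subst b.
have [u' [-> e']] := IH u ax ay le_vu exy.
by exists u'; rewrite catA.
Qed.

(** Intervals are closed on the left and open on the right, so an itinerary survives small moves to
    the right. *)
Lemma adm_near x w : adm S x w ->
  exists2 e, 0 < e & forall y, x <= y < x + e -> adm S y w.
Proof.
elim: w x => [|a w IH] x /=; first by exists 1; [lra|].
case=> ax /IH[e e0 he]; exists (Rmin e (lpt S a + len S a - x)).
  by apply: Rmin_pos => //; move: ax; rewrite /inT; lra.
move=> y [xy yx]; have := Rmin_l e (lpt S a + len S a - x).
have := Rmin_r e (lpt S a + len S a - x); move: ax; rewrite /inT => ? ? ?.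
by split; [lra|apply: he; lra].
Qed.

End Exchange.

(* S' is the first return of S to the interval of the letter a, points of the c-th interval of S'
   returning along the word s c. In ind_disc each interior division point of S is reached from an
   interior division point of S' no later than its return. *)
Record induced (S : sys) (s : morph) (S' : sys) (a : 'I_3) : Prop := Induced {
  ind_dom : forall x, inI S' x <-> inT S a x;
  ind_word : forall c, exists2 r, s c = a :: r & a \notin r;
  ind_tr : forall c, tr S' c = sh S (s c);
  ind_adm : forall c x, inT S' c x -> adm S x (s c);
  ind_cover : forall x, inI S x -> exists c u v,
    [/\ s c = u ++ v, v <> [::] & inT S' c (x - sh S u)];
  ind_disc : exists (f : 'I_3 -> 'I_3) (U : 'I_3 -> seq 'I_3),
    [/\ injective f, f (top S l1) = top S' l1 &
     forall b, b <> top S l1 -> [/\ U b <> [::], exists v, s (f b) = U b ++ v &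
        lpt S b = lpt S' (f b) + sh S (U b)]] }.

(* A connection in Keane's sense. As b = b' is allowed, absence of connections is regularity. *)
Definition conn (S : sys) (b b' : 'I_3) (w : seq 'I_3) : Prop :=
  [/\ b <> top S l1, b' <> top S l1, w <> [::], adm S (lpt S b) w &
      lpt S b' = lpt S b + sh S w].

Definition noconn (S : sys) : Prop := forall b b' w, ~ conn S b b' w.

(** * Return words, and connections under induction *)

Section Return.
Variables (S S' : sys) (s : morph) (a : 'I_3).
Hypotheses (wfS : wf S) (wfS' : wf S') (H : induced S s S' a).

Let subst (w : seq 'I_3) := flatten (map s w).

Lemma subst_sh w : sh S (subst w) = sh S' w.
Proof. by elim: w => [|c w IH] //=; rewrite /subst /= sh_cat IH (ind_tr H). Qed.

Lemma subst_adm x w : adm S' x w -> adm S x (subst w).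
Proof.
elim: w x => [|c w IH] x //= [cx /IH]; rewrite /subst /= => h.
by apply/adm_cat; split; [exact: ind_adm H _ _ cx|rewrite -(ind_tr H)].
Qed.

Lemma size_subst w : (size w <= size (subst w))%N.
Proof.
elim: w => [|c w IH] //; rewrite /subst /= size_cat.
by case: (ind_word H c) => r -> _ /=; rewrite addSn ltnS (leq_trans IH) ?leq_addl.
Qed.

(** The letter [a] occurs in a return word only at its beginning, whereas the points of [S'] are
    exactly those coded by [a]. *)
Lemma return_first c x u v : inT S' c x -> s c = u ++ v -> u <> [::] ->
  v <> [::] -> ~ inI S' (x + sh S u).
Proof.
move=> cx e u0 v0 /(ind_dom H) ax.
have [r er ar] := ind_word H c; have := ind_adm H cx.
rewrite e => /adm_cat[_]; move: e; rewrite er.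
case: u u0 ax => [//|a' u] _ ax [_ e]; case: v v0 e => [//|d v] _ e [dx _].
by move: ar; rewrite e (inT_uniq wfS ax dx) mem_cat mem_head orbT.
Qed.

(** Return words are split off from the left, by induction on the length. *)
Lemma decode x w : inI S' x -> adm S x w -> inI S' (x + sh S w) ->
  exists2 w', w = subst w' & adm S' x w'.
Proof.
have [n] := ubnP (size w); elim: n w x => [//|n IH] w x le_wn Ix aw Iw.
case: w le_wn aw Iw => [|d w]; first by exists [::].
move=> le_wn aw Iw; have [c cx] := inI_cover wfS' Ix.
have ac := ind_adm H cx; case: (leqP (size (s c)) (size (d :: w))) => le_cw.
  have [w2 e2] := adm_prefix wfS ac aw le_cw.
  move: aw Iw; rewrite e2 sh_cat -Rplus_assoc -(ind_tr H) => /adm_cat[_ aw2] Iw2.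
  have lt_w2 : (size w2 < n)%N.
    move: le_wn; rewrite e2 size_cat; case: (ind_word H c) => r -> _ /=.
    by rewrite addSn ltnS; apply: leq_ltn_trans; rewrite leq_addl.
  rewrite -(ind_tr H) in aw2.
  have [w' ew' aw'] := IH _ _ lt_w2 (step_inI wfS' cx) aw2 Iw2.
  by exists (c :: w'); rewrite // ew'.
(* A remainder shorter than the next return word would come back to [S'] too early. *)
have [v e] := adm_prefix wfS aw ac (ltnW le_cw).
case: (@return_first c x (d :: w) v) => // v0.
by move: le_cw; rewrite e v0 cats0 ltnn.
Qed.

(** Division points of [S] lie ahead of those of [S'] by the words [U]. So substitute return words,
    cut the initial [U] off the front and append the [U] of the target. Hence absence of connections
    passes to the induced system. *)
Lemma conn_lift b b' w' : conn S' b b' w' -> exists c c' w, conn S c c' w.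
Proof.
case=> b0 b'0 w0 aw e; have [f [U [fI f0 fU]]] := ind_disc H.
have [g gK gK'] := injF_bij fI.
have fg d : d <> top S' l1 -> g d <> top S l1.
  by move=> d0 e1; apply: d0; rewrite -f0 -e1 gK'.
have [Ub [v ev] lb] := fU _ (fg _ b0); have [Ub' [v' ev'] lb'] := fU _ (fg _ b'0).
rewrite gK' in ev lb; rewrite gK' in ev' lb'.
case: w' w0 aw e => [//|d w'] _ aw e.
have ed : d = b by case: aw => dx _; apply: (inT_uniq wfS' dx); exact: lpt_in.
subst d; have := subst_adm aw; have := subst_sh (b :: w').
rewrite /subst /= ev -catA; set r := v ++ _ => es /adm_cat[_]; rewrite -lb => ar.
exists (g b), (g b'), (r ++ U (g b')); split; [exact: fg|exact: fg| | |].
- by case: (r) => //; case: (U (g b')) Ub'.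
- apply/adm_cat; split=> //.
  rewrite lb Rplus_assoc -sh_cat -/r es -e.
  have /(ind_adm H) := lpt_in wfS' b'.
  by rewrite ev' => /adm_cat[].
- by rewrite lb' e /= -es !sh_cat lb; lra.
Qed.

(* Cut the segment, prolonged back to an interior division point of S', into return words. If no
   letter is lost then b = a, so the connection starts at the left endpoint of S' and the new one
   reaches that endpoint in one step; this cannot happen twice in a row. *)
Lemma conn_descend b b2 w : conn S b b2 w -> exists c c2 w', conn S' c c2 w' /\
  ((size w' < size w)%N \/
   [/\ size w' = size w, b = a, lpt S' c + tr S' c = lpt S b &
       inI S' (lpt S b + tr S b) \/ lpt S b2 = lpt S b + tr S b]).
Proof.
case=> b0 b20 w0 aw e; have [f [U [fI f0 fU]]] := ind_disc H.
have ft d : d <> top S l1 -> f d <> top S' l1 by rewrite -f0 => d0 /fI.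
have [u0 [v ev] eb] := fU _ b0; have [u20 [v2 ev2] eb2] := fU _ b20.
set c := f b in ev eb; set c2 := f b2 in ev2 eb2.
set u := U b in u0 ev eb; set u2 := U b2 in u20 ev2 eb2.
have cx := lpt_in wfS' c; have cx2 := lpt_in wfS' c2.
have /adm_cat[au av] : adm S (lpt S' c) (u ++ v) by rewrite -ev; apply: ind_adm H _ _ cx.
have /adm_cat[au2 _] : adm S (lpt S' c2) (u2 ++ v2) by rewrite -ev2; apply: ind_adm H _ _ cx2.
have e2 : lpt S b + sh S w = lpt S' c2 + sh S u2 by rewrite -eb2.
(* If [w] is shorter than [u2], both [lpt S' c] and [lpt S' c2] precede [lpt S b], by [u] and [t].
   The later of the two is met strictly inside a return word of the other, which is impossible,
   unless they coincide; then [w] is empty. *)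
case: (leqP (size u2) (size w)) => le_uw; last first.
  have [t [et ebt]] := adm_suffix wfS au2 aw (ltnW le_uw) (esym e2).
  have t0 : t <> [::] by move=> t0; move: le_uw; rewrite et t0 ltnn.
  move: au2; rewrite et => /adm_cat[at_ _].
  rewrite et -catA in ev2.
  case: (leqP (size t) (size u)) => le_tu.
    have [u' [eu eu']] := adm_suffix wfS au at_ le_tu ltac:(lra).
    case: (u' =P [::]) => [u'0|u'0].
      move: eu eu'; rewrite u'0 /= => eu; rewrite Rplus_0_r => /(lpt_inj wfS')/fI bb2.
      case: w0; move/(congr1 size): et; rewrite -eu /u /u2 bb2 size_cat => /eqP.
      by rewrite -{1}[size (U b2)]addn0 eqn_add2l => /eqP/esym/size0nil.
    exfalso; apply: (@return_first c (lpt S' c) u' (t ++ v)) => //.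
    - by rewrite ev eu catA.
    - by case: (t) t0.
    - by rewrite eu'; apply: inT_inI cx2.
  have [t' [et' et2]] := adm_suffix wfS at_ au (ltnW le_tu) ltac:(lra).
  exfalso; apply: (@return_first c2 (lpt S' c2) t' (u ++ w ++ v2)) => //.
  - by rewrite ev2 et' -catA.
  - by move=> t'0; move: le_tu; rewrite et' t'0 ltnn.
  - by case: (u) u0.
  - by rewrite et2; apply: inT_inI cx.
(* Otherwise [u ++ w1] leads from [lpt S' c] to [lpt S' c2], both in the interval of [S'], and can
   be decoded. *)
have [w1 [ew ew1]] := adm_suffix wfS aw au2 le_uw e2.
have Iw : inI S' (lpt S' c + sh S (u ++ w1)).
  by rewrite sh_cat -Rplus_assoc -eb ew1; apply: inT_inI cx2.
have auw : adm S (lpt S' c) (u ++ w1).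
  by apply/adm_cat; split=> //; rewrite -eb; move: aw; rewrite ew => /adm_cat[].
have [w' ew' aw'] := decode (inT_inI wfS' cx) auw Iw.
case: w' ew' aw' => [|d w'] ew' aw'; first by case: (u) u0 ew'.
have dc : d = c by case: aw' => dx _; apply: (inT_uniq wfS' dx cx).
subst d; exists c, c2, (c :: w'); split.
  split=> //; [exact: ft|exact: ft|].
  by rewrite -subst_sh -ew' sh_cat -Rplus_assoc -eb ew1.
have := ew'; rewrite /subst /= ev => /(congr1 size).
rewrite !size_cat -/(subst w') => es.
have := size_subst w' => le_w'.
have u21 : (0 < size u2)%N by case: (u2) u20.
have : size w = (size w1 + size u2)%N by rewrite ew size_cat.
(* As [size w1 = size v + size (subst w')] and [u2] is non-empty, losing no letter forces [v] to be
   empty and all letters of [w'] to return in one step. *)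
case: (leqP (size w) (size w').+1) => lt_w; last by left.
move=> sw; right.
have v0 : v = [::] by apply: size0nil; lia.
have esw : size w' = size (subst w') by lia.
have eu : s c = u by rewrite ev v0 cats0.
have etr : lpt S' c + tr S' c = lpt S b by rewrite (ind_tr H) eu.
have ba : b = a.
  apply: (inT_uniq wfS (lpt_in wfS b)); apply/(ind_dom H).
  by rewrite -etr; apply: step_inI.
split=> //; first by lia.
case: w' aw' ew' es le_w' esw lt_w => [|d w'] aw' ew' es le_w' esw lt_w.
  right; have : size w = 1%N by move: es lt_w; rewrite v0 /=; lia.
  case: (w) aw e => [//|d [|//]] /= [dx _] -> _.
  by rewrite (inT_uniq wfS dx (lpt_in wfS b)); lra.
left; move: aw' => [_ [dx _]]; rewrite etr in dx.
have sd : s d = [:: a].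
  have [r er _] := ind_word H d; move: esw; rewrite /subst /= size_cat er /= -/(subst w').
  have := size_subst w'; move=> ? ?; have : size r = 0%N by lia.
  by move/size0nil->.
by have := step_inI wfS' dx; rewrite (ind_tr H) sd /= ba Rplus_0_r.
Qed.

End Return.

(** * Infinite chains of induced systems *)

(* One of the outer thirds of an interval misses any given interval of less than a third its
   length. *)
Lemma avoid_intervals (m : nat) (c : nat -> R) (d x e : R) : 0 <= d ->
  d * 3 ^ m < e ->
  exists2 y, x <= y < x + e & forall i, (i < m)%N -> ~ (c i <= y < c i + d).
Proof.
move=> d0; elim: m x e => [|m IH] x e /= de.
  by exists x => //; lra.
have p3 : 1 <= 3 ^ m by apply: pow_R1_Rle; lra.
have d3 : d <= d * 3 ^ m by rewrite -{1}[d]Rmult_1_r; apply: Rmult_le_compat_l.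
have [x' [xx' x'x h]] : exists x', [/\ x <= x', x' + e / 3 <= x + e &
    forall y, x' <= y < x' + e / 3 -> ~ (c m <= y < c m + d)].
  case: (Rlt_le_dec (c m) (x + e / 3)) => h.
    by exists (x + 2 * (e / 3)); split; [lra|lra|move=> y; lra].
  by exists x; split; [lra|lra|move=> y; lra].
have [|y [y1 y2] hy] := IH x' (e / 3); first by lra.
exists y; first by lra.
move=> i; rewrite ltnS leq_eqVlt => /orP[/eqP->|]; last exact: hy.
by apply: h; lra.
Qed.

Section Chain.
Variables (S : nat -> sys) (s : nat -> morph) (a : nat -> 'I_3).
Hypothesis wfS : forall n, wf (S n).
Hypothesis indS : forall n, induced (S n) (s n) (S n.+1) (a n).

(** Infinite descent on the number of steps, going down a second level whenever the first one loses
    no letter. *)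
Lemma chain_noconn n : noconn (S n).
Proof.
move=> b b' w; have [k] := ubnP (size w).
elim: k n b b' w => [//|k IH] n b b' w le_wk h.
have [c [c2 [w' [h' [lt_w|[e1 ba etr _]]]]]] := conn_descend (wfS n) (wfS n.+1) (indS n) h.
  by apply: (IH _ _ _ _ _ h'); apply: leq_trans lt_w _.
have [d [d2 [w'' [h'' [lt_w|[_ ca _ hc]]]]]] :=
    conn_descend (wfS n.+1) (wfS n.+2) (indS n.+1) h'.
  by apply: (IH _ _ _ _ _ h''); rewrite -e1 in le_wk; apply: leq_trans lt_w _.
have c0 : c <> top (S n.+1) l1 by case: h'.
have lc : lft (S n.+1) < lpt (S n.+1) c by apply: lpt_gt.
have lb : lpt (S n) b = lft (S n.+1).
  have d0 := ind_dom (indS n).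
  have := lpt_in (wfS n) (a n); have := lft_inI (wfS n.+1).
  by rewrite !ba; move/d0 => h1 /d0 h2; move: h1 h2; rewrite /inT /inI; lra.
(* The division point [c] is sent to the left endpoint of [S n.+1]. That endpoint lies outside the
   interval of [c] and is no interior division point, so both alternatives fail. *)
rewrite etr lb in hc; case: hc => hc.
  have := ind_dom (indS n.+1) (lft (S n.+1)); case=> /(_ hc) + _.
  by rewrite -ca /inT; lra.
have [_ c20 _ _ _] := h'.
by have := lpt_gt (wfS n.+1) c20; lra.
Qed.

Lemma prodm_sh n k c : sh (S n) (prodm s n k c) = tr (S (n + k)%N) c.
Proof.
elim: k n c => [|k IH] n c /=; first by rewrite addn0; lra.
by rewrite /Defs.comp (subst_sh (indS n)) IH addSnnS.
Qed.

Lemma prodm_adm n k c x : inT (S (n + k)%N) c x -> adm (S n) x (prodm s n k c).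
Proof.
elim: k n c x => [|k IH] n c x /=; first by rewrite addn0.
by rewrite -addSnnS => /IH /(subst_adm (indS n)).
Qed.

(** The Rokhlin towers are nested: the base point of [x] in its tower over the next interval lies
    itself in a tower over the last one. *)
Lemma prodm_cover n k x : inI (S n) x -> exists c u v,
  [/\ prodm s n k c = u ++ v, v <> [::] & inT (S (n + k)%N) c (x - sh (S n) u)].
Proof.
elim: k n x => [|k IH] n x Ix.
  have [c cx] := inI_cover (wfS n) Ix.
  by exists c, [::], [:: c]; split; rewrite //= addn0 Rminus_0_r.
have [d [u1 [v1 [e1 v10 dx]]]] := ind_cover (indS n) Ix.
have [c [u2 [v2 [e2 v20 cx]]]] := IH n.+1 _ (inT_inI (wfS n.+1) dx).
have := prodm_adm (n := n.+1) cx; rewrite e2 => /adm_cat[_].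
rewrite (_ : x - sh (S n) u1 - sh (S n.+1) u2 + sh (S n.+1) u2 = x - sh (S n) u1); last by lra.
case: v2 v20 e2 => [//|d' v2] _ e2 /= [d'x _].
(* The letter following [u2] codes the same base point as [d], so the outer word continues with
   [s n d]. *)
have dd : d' = d by apply: inT_uniq (wfS n.+1) _ _ _ d'x dx.
subst d'.
exists c, (flatten (map (s n) u2) ++ u1), (v1 ++ flatten (map (s n) v2)); split.
- by rewrite /= /Defs.comp e2 map_cat flatten_cat /= e1 !catA.
- by case: (v1) v10.
- rewrite addnS sh_cat (subst_sh (indS n)).
  by move: cx; rewrite addSn; congr inT; lra.
Qed.

Hypothesis shrink : forall e, 0 < e -> exists N, total (len (S N)) < e.

(* A point coded by w may be chosen off the preimages T^-i(I_N), i < |w|, for I_N is short; then w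
   does not straddle two return words to I_N. *)
Lemma chain_language w :
  (exists2 x, inI (S 0) x & adm (S 0) x w) <-> exists N c, infix w (prodm s 0 N c).
Proof.
split=> [[x Ix aw]|[N [c /infixP[u [v e]]]]]; last first.
  have := prodm_adm (n := 0) (lpt_in (wfS (0 + N)%N) c).
  have Ic : inI (S 0) (lpt (S (0 + N)%N) c).
    elim: (0 + N)%N {e} (lpt _ c) (inT_inI (wfS _) (lpt_in (wfS (0 + N)%N) c)) => // m IH y.
    by move/(ind_dom (indS m))/(inT_inI (wfS m))/IH.
  rewrite e => /adm_cat[au /adm_cat[aw _]].
  by exists (lpt (S (0 + N)%N) c + sh (S 0) u) => //; apply: adm_inI.
have [e e0 he] := adm_near aw.
(* The second bound keeps the perturbed point inside the interval of [S 0]. *)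
pose e' := Rmin e (lft (S 0) + total (len (S 0)) - x).
have e'0 : 0 < e' by apply: Rmin_pos => //; move: Ix; rewrite /inI; lra.
have [N hN] : exists N, total (len (S N)) < e' / 3 ^ size w.
  by apply: shrink; apply: Rdiv_lt_0_compat => //; apply: pow_lt; lra.
have dN := total_len_gt0 (wfS N).
have [||y [xy yx] hy] := @avoid_intervals (size w)
    (fun i => lft (S N) - sh (S 0) (take i w)) (total (len (S N))) x e'.
- by lra.
- have p0 : 0 < 3 ^ size w by apply: pow_lt; lra.
  move: (Rmult_lt_compat_r _ _ _ p0 hN).
  by rewrite /Rdiv Rmult_assoc Rinv_l ?Rmult_1_r; lra.
have := Rmin_l e (lft (S 0) + total (len (S 0)) - x).
have := Rmin_r e (lft (S 0) + total (len (S 0)) - x); rewrite -/e' => l1' l2'.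
have ay : adm (S 0) y w by apply: he; lra.
have Iy : inI (S 0) y by move: Ix; rewrite /inI; lra.
have [c [u [v [ec v0 cx]]]] := prodm_cover N Iy.
exists N, c; rewrite ec; have := prodm_adm cx; rewrite ec => /adm_cat[_].
rewrite (_ : y - sh (S 0) u + sh (S 0) u = y); last by lra.
move=> av; case: (leqP (size w) (size v)) => le_wv.
  have [v' ->] := adm_prefix (wfS 0) ay av le_wv.
  by apply/infixP; exists u, v'.
have [w' ew] := adm_prefix (wfS 0) av ay (ltnW le_wv).
(* A return word ending inside [w] would put [y] back into the interval of [S N] after [size v]
   letters, which the choice of [y] excludes. *)
case: (hy (size v) le_wv); rewrite ew take_size_cat //.
have := step_inI (wfS _) cx; rewrite -prodm_sh ec sh_cat add0n /inI; lra.
Qed.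

End Chain.

(** * Natural codings and regularity *)

Lemma enum3 : enum 'I_3 = [:: l1; l2; l3].
Proof. by apply: (inj_map val_inj); rewrite val_enum_ord. Qed.

Lemma left_end_lend l lam (p : {perm 'I_3}) a : left_end l lam p a = lend l lam p a.
Proof.
rewrite /left_end /Rsum enum3 /Defs.pos /lend; elim/ord3_ind: a => /=.
all: have := permKV p l3; have := permKV p l2; have := permKV p l1.

all: elim/ord3_ind: (p^-1%g l1); elim/ord3_ind: (p^-1%g l2); elim/ord3_ind: (p^-1%g l3) =>
  e1 e2 e3; try (by rewrite e1 in e2); try (by rewrite e1 in e3); try (by rewrite e2 in e3);
  rewrite ?e1 ?e2 ?e3 /=; lra.
Qed.

Lemma RlebP x y : Rleb x y <-> x <= y.
Proof. by rewrite /Rleb; case: Rle_dec => h; split. Qed.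

Lemma RltbP x y : Rltb x y <-> x < y.
Proof. by rewrite /Rltb; case: Rlt_dec => h; split. Qed.

Lemma In_map (A : Type) (f : nat -> A) k s : k \in s -> List.In (f k) (map f s).
Proof.
by elim: s => //= j s IH; rewrite inE => /orP[/eqP->|/IH]; [left|right].
Qed.

Section Bridge.
(** The permutation [q] renames the letters of [S] into those of the exchange, so that [S] may use
    the fixed letters of a vertex. *)
Variables (l r : R) (lam : 'I_3 -> R) (p0 p1 q : {perm 'I_3}) (S : sys).
Hypotheses (wfS : wf S) (e0 : forall i, p0 i = q (top S i)) (e1 : forall i, p1 i = q (bot S i)).
Hypotheses (el : lft S = l) (elen : forall a, len S a = lam (q a)).

Lemma left_end0 a : left_end l lam p0 (q a) = lpt S a.
Proof.
by rewrite left_end_lend /lpt /lend !e0 !(inj_eq perm_inj) !elen el.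
Qed.

Lemma left_end1 a : left_end l lam p1 (q a) = bpt S a.
Proof.
by rewrite left_end_lend /bpt /lend !e1 !(inj_eq perm_inj) !elen el.
Qed.

Lemma inIbP a x : inIb l lam p0 (q a) x <-> inT S a x.
Proof.
rewrite /inIb left_end0 -elen /inT; split.
  by move/andP => [/RlebP ? /RltbP ?].
by case=> /RlebP-> /RltbP->.
Qed.

Lemma inJbP a x : inJb l lam p1 (q a) x <-> bpt S a <= x < bpt S a + len S a.
Proof.
rewrite /inJb left_end1 -elen; split.
  by move/andP => [/RlebP ? /RltbP ?].
by case=> /RlebP-> /RltbP->.
Qed.

Lemma T_step a x : inT S a x -> T l lam p0 p1 x = x + tr S a.
Proof.
move=> ax; rewrite /T; case: pickP => [b|/(_ (q a))]; last by move/negP; case; apply/inIbP.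
rewrite -(permKV q b) => /inIbP bx; rewrite (inT_uniq wfS bx ax) left_end0 left_end1 /tr; lra.
Qed.

Lemma Tinv_step a x : inT S a x -> Tinv l lam p0 p1 (x + tr S a) = x.
Proof.
move=> ax; rewrite /Tinv; case: pickP => [b|/(_ (q a))]; last first.
  by move/negP; case; apply/inJbP; apply: bpt_tr.
rewrite -(permKV q b) => /inJbP bx; have [_ bI len0] := wfS.
by rewrite (tile_uniq bI len0 bx (bpt_tr ax)) left_end0 left_end1 /tr; lra.
Qed.

Lemma adm_fromP x w : adm_from l lam p0 p1 x (map q w) <-> adm S x w.
Proof.
elim: w x => [|a w IH] x //=; split=> -[].
  by move/inIbP => ax; rewrite (T_step ax) => /IH.
by move=> ax aw; split; [exact/inIbP|rewrite (T_step ax); apply/IH].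
Qed.

Lemma iter_T x w : adm S x w -> iter (size w) (T l lam p0 p1) x = x + sh S w.
Proof.
elim: w x => [|a w IH] x /=; first by rewrite Rplus_0_r.
by case=> ax /IH e; rewrite -iterS iterSr (T_step ax) e; lra.
Qed.

Lemma T_inI x : inI S x -> inI S (T l lam p0 p1 x).
Proof. by case/(inI_cover wfS) => a ax; rewrite (T_step ax); apply: step_inI. Qed.

Lemma TK x : inI S x -> Tinv l lam p0 p1 (T l lam p0 p1 x) = x.
Proof. by case/(inI_cover wfS) => a ax; rewrite (T_step ax) (Tinv_step ax). Qed.

Lemma TinvK x : inI S x -> T l lam p0 p1 (Tinv l lam p0 p1 x) = x.
Proof. by case/(step_onto wfS) => a [y [ay ->]]; rewrite (Tinv_step ay) (T_step ay). Qed.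

Lemma Tinv_inI x : inI S x -> inI S (Tinv l lam p0 p1 x).
Proof.
by case/(step_onto wfS) => a [y [ay ->]]; rewrite (Tinv_step ay); apply: inT_inI ay.
Qed.

Local Notation t := (T l lam p0 p1).
Local Notation ti := (Tinv l lam p0 p1).

Lemma iterT_inI n x : inI S x -> inI S (iter n t x).
Proof. by move=> Ix; elim: n => //= n; apply: T_inI. Qed.

Lemma iterTinv_inI n x : inI S x -> inI S (iter n ti x).
Proof. by move=> Ix; elim: n => //= n; apply: Tinv_inI. Qed.

Lemma iterTK n x : inI S x -> iter n ti (iter n t x) = x.
Proof.
move=> Ix; elim: n => //= n IH; rewrite -iterS iterSr TK //.
exact: iterT_inI.
Qed.

Lemma iterTinvK n x : inI S x -> iter n t (iter n ti x) = x.
Proof.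
move=> Ix; elim: n => //= n IH; rewrite -iterS iterSr TinvK //.
exact: iterTinv_inI.
Qed.

Lemma mu_lpt (i : 'I_3) : mu l lam p0 i = lpt S (top S i).
Proof. by rewrite -left_end0 -e0 /left_end /Defs.pos permK. Qed.

Lemma lpt_inI a : inI S (lpt S a).
Proof. by apply: inT_inI (lpt_in wfS a). Qed.

Lemma mu_inI (i : 'I_3) : inI S (mu l lam p0 i).
Proof. by rewrite mu_lpt; apply: lpt_inI. Qed.

(** A connection between distinct division points makes their orbits meet; one from a point to
    itself makes its orbit periodic, hence finite. *)
Lemma regular_noconn : regular l lam p0 p1 -> noconn S.
Proof.
case=> inf dis b b' w [b0 b'0 w0 aw eb].
have ht := iter_T aw; rewrite -eb in ht.
have [tI _ _] := wfS.
have [i ei] : exists i, b = top S i.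
  by have [g _ gK] := injF_bij tI; exists (g b); rewrite gK.
have [j ej] : exists i, b' = top S i.
  by have [g _ gK] := injF_bij tI; exists (g b'); rewrite gK.
subst b b'; rewrite -!mu_lpt in ht.
have pos_i (k : 'I_3) : top S k <> top S l1 -> (0 < k)%N.
  by case: k => [[|k] hk] //; case; congr (top S _); apply: val_inj.
have i0 := pos_i _ b0; have j0 := pos_i _ b'0.
have ij : Defs.orbit l lam p0 p1 (mu l lam p0 i) (mu l lam p0 j).
  exists (Z.of_nat (size w)); case: (size w) ht (@size0nil _ w) => [_ /(_ erefl) //|n ht _].
  by rewrite /= SuccNat2Pos.id_succ.
have jj : Defs.orbit l lam p0 p1 (mu l lam p0 j) (mu l lam p0 j) by exists 0%Z.
case: (ltngtP i j) => lt_ij.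
- exact: dis lt_ij (ltn_ord j) _ ij jj.
- exact: dis lt_ij (ltn_ord i) _ jj ij.
apply: (inf i); first by rewrite i0 /=.
rewrite -lt_ij in ht; set m := mu _ _ _ _ in ht *; have Im : inI S m by apply: mu_inI.
set n := size w in ht; have n0 : (0 < n)%N by rewrite /n; case: (w) w0.
exists (map (fun k => iter k t m) (iota 0 n)).
have closedT y : (exists2 k, (k < n)%N & y = iter k t m) ->
    exists2 k, (k < n)%N & t y = iter k t m.
  case=> k lt_kn ->; rewrite -iterS; case: (ltnP k.+1 n) => h; first by exists k.+1.
  by exists 0%N => //; have <- : n = k.+1 by apply/eqP; rewrite eqn_leq h.
(* Backwards, [m] itself goes to the iterate [n.-1], by periodicity. *)
have closedTi y : (exists2 k, (k < n)%N & y = iter k t m) ->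
    exists2 k, (k < n)%N & ti y = iter k t m.
  case=> -[|k] lt_kn ->; last first.
    by exists k; [exact: ltnW|rewrite iterS TK //; apply: iterT_inI].
  exists n.-1; first by rewrite prednK.
  by rewrite -{1}[m]/(iter 0 t m) /= -{1}ht -{1}(prednK n0) iterS TK //; apply: iterT_inI.
move=> y [z <-].
suff [k lt_kn ->] : exists2 k, (k < n)%N & Tpow l lam p0 p1 z m = iter k t m.
  by apply: (In_map (fun k => iter k t m)); rewrite mem_iota.
have hm : exists2 k, (k < n)%N & m = iter k t m by exists 0%N.
case: z => [|k|k] //=; elim: (Pos.to_nat k) => //= *; [exact: closedT|exact: closedTi].
Qed.


Lemma iterT_conn n (i j : 'I_3) : i <> l1 -> j <> l1 -> (0 < n)%N ->
  noconn S -> iter n t (mu l lam p0 i) <> mu l lam p0 j.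
Proof.
have [tI _ _] := wfS.
move=> i0 j0 n0 nc; have [w sw aw] := adm_ex wfS n (mu_inI i).
rewrite -sw (iter_T aw) !mu_lpt => e; rewrite mu_lpt in aw.
apply: (nc (top S i) (top S j) w); split=> //.
- by move/tI.
- by move/tI.
- by move=> w0; rewrite w0 in sw; rewrite -sw in n0.
Qed.

(** Applying the exchange often enough removes negative powers, and injectivity cancels common
    iterates. A coincidence thus becomes a forward iterate of one division point hitting another, or
    itself. *)
Lemma noconn_regular : noconn S -> regular l lam p0 p1.
Proof.
move=> nc; have [tI _ _] := wfS.
have cancel_iter m n x y : inI S x -> inI S y -> (m <= n)%N ->
    iter m t x = iter n t y -> x = iter (n - m) t y.
  move=> Ix Iy le_mn; rewrite -{1}(subnKC le_mn) iterD => /(congr1 (iter m ti)).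
  by rewrite !iterTK //; apply: iterT_inI.
have mu_ord (i : nat) : (0 < i < 3)%N -> exists2 k : 'I_3, k <> l1 & i = k.
  case/andP=> i0 i3; exists (Ordinal i3) => // /(congr1 val) /= i1.
  by rewrite i1 in i0.
split.
  move=> i hi [s hs]; have [k k0 ek] := mu_ord _ hi; subst i.
  pose f n := iter n t (mu l lam p0 k).
  have fin : injective f.
    move=> m n; wlog le_mn : m n / (m <= n)%N.
      by move=> W e; case: (leqP m n) => [/W->|/ltnW/W->].
    move=> e; apply/eqP; rewrite eqn_leq le_mn /= leqNgt; apply/negP => lt_mn.
    apply: (@iterT_conn (n - m)%N k k) => //; first by rewrite subn_gt0.
    by rewrite -(cancel_iter m n (mu l lam p0 k) _ _ _ _ e) //; apply: mu_inI.
  (* Pigeonhole: one more iterate than the list has entries. *)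
  have sub : List.incl (List.map f (List.seq 0 (length s).+1)) s.
    move=> y /List.in_map_iff[n [<- _]]; apply: hs; exists (Z.of_nat n).
    by case: n => [|n] //=; rewrite SuccNat2Pos.id_succ.
  have nd : List.NoDup (List.map f (List.seq 0 (length s).+1)).
    by apply: List.NoDup_map_NoDup_ForallPairs (List.seq_NoDup _ _) => m n _ _; apply: fin.
  have := List.NoDup_incl_length nd sub.
  by rewrite List.length_map List.length_seq; lia.
have Tpow_nonneg z x : inI S x -> exists n m,
    iter n t (Tpow l lam p0 p1 z x) = iter m t x /\ inI S (Tpow l lam p0 p1 z x).
  move=> Ix; case: z => [|k|k] /=; first by exists 0%N, 0%N.
    by exists 0%N, (Pos.to_nat k); split=> //; apply: iterT_inI.
  by exists (Pos.to_nat k), 0%N; split; [rewrite iterTinvK|apply: iterTinv_inI].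
move=> i j hi lt_ij hj y [z ez] [z' ez'].
have [k k0 ek] : exists2 k : 'I_3, k <> l1 & i = k by apply: mu_ord; lia.
have [k' k'0 ek'] : exists2 k : 'I_3, k <> l1 & j = k by apply: mu_ord; lia.
have kk' : k <> k' by move=> kk'; move: lt_ij; rewrite ek ek' kk' ltnn.
subst i j.
have [n [m [e Iy]]] := Tpow_nonneg z _ (mu_inI k); rewrite ez in e Iy.
have [n' [m' [e' _]]] := Tpow_nonneg z' _ (mu_inI k'); rewrite ez' in e'.
have ee : iter (n' + m) t (mu l lam p0 k) = iter (n + m') t (mu l lam p0 k').
  by rewrite !iterD -e -e' -!iterD addnC.
have [Ik Ik'] := (mu_inI k, mu_inI k').
case: (ltngtP (n' + m) (n + m')) => h.
- apply: (@iterT_conn (n + m' - (n' + m))%N k' k) => //; first by rewrite subn_gt0.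
  exact: esym (cancel_iter _ _ _ _ Ik Ik' (ltnW h) ee).
- apply: (@iterT_conn (n' + m - (n + m'))%N k k') => //; first by rewrite subn_gt0.
  exact: esym (cancel_iter _ _ _ _ Ik' Ik (ltnW h) (esym ee)).
- have := cancel_iter _ _ _ _ Ik Ik' (eq_leq h) ee; rewrite h subnn /= !mu_lpt.
  by move/(lpt_inj wfS)/tI.
Qed.

Lemma coding_lang x : Rsum predT lam = r - l ->
  natural_coding l r lam p0 p1 x <->
  forall i m, exists2 y, inI S y & adm S y (map (q^-1)%g (factor x i m)).
Proof.
rewrite /Rsum enum3 /= => er.
have etot : total (len S) = r - l.
  rewrite (_ : total (len S) = total lam); first by rewrite /total -er; lra.
  by rewrite (total_order lam (@perm_inj _ q)) /total !elen.
split=> h i m; have := h i m.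
  case=> y [ly [yr ay]]; exists y; first by rewrite /inI etot el; lra.
  by apply/adm_fromP; rewrite mapK //; apply: permKV.
case=> y Iy /adm_fromP; rewrite mapK; last exact: permKV.
by move=> ay; exists y; move: Iy; rewrite /inI etot el => -[]; split; [lra|split; [lra|]].
Qed.

End Bridge.

(** * The edges of the graph as first return maps *)

Definition tri {A : Type} (a b c : A) : 'I_3 -> A :=
  fun i => if i == l1 then a else if i == l2 then b else c.
Arguments tri {A} a b c i /.

(* Orders of the intervals before and after the exchange at a vertex of the graph. The exchange
   is only determined up to a reflection of the line, recorded by the boolean. *)
Definition vtop (v : vertex) (o : bool) : 'I_3 -> 'I_3 :=
  match v, o with
  | V33, false => tri l1 l3 l2 | V33, true => tri l2 l3 l1
  | V32, false => tri l3 l2 l1 | V32, true => tri l1 l2 l3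
  end.

Definition vbot (v : vertex) (o : bool) : 'I_3 -> 'I_3 :=
  match v, o with
  | V33, false => tri l2 l3 l1 | V33, true => tri l1 l3 l2
  | V32, false => tri l1 l3 l2 | V32, true => tri l2 l3 l1
  end.

Definition vsys v o l lam : sys := Sys (vtop v o) (vbot v o) l lam.

Lemma vsys_wf v o l lam : (forall a, 0 < lam a) -> wf (vsys v o l lam).
Proof.
by move=> lam0; split=> //; case: v; case: o; apply: ord3_ind; apply: ord3_ind.
Qed.

(** One constructor per edge label; the second letter abbreviates alpha, zeta, eta, beta, gamma or
    delta. At [V33] the digit tells which of [l1] and [l2] is induced on. *)
Inductive kind := KA1 | KA2 | KZ1 of nat | KZ2 of nat | KA | KH | KB | KG | KD of nat.

Definition ksrc (e : kind) : vertex :=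
  match e with KA1 | KA2 | KZ1 _ | KZ2 _ => V33 | _ => V32 end.
Definition kdst (e : kind) : vertex :=
  match e with KA | KH => V32 | _ => V33 end.
Definition kletter (e : kind) : 'I_3 :=
  match e with KA1 | KZ1 _ | KA | KH => l1 | KA2 | KZ2 _ | KG | KD _ => l2 | KB => l3 end.
(** Whether the induced exchange shows its vertex in the opposite orientation. *)
Definition kflip (e : kind) (o : bool) : bool :=
  match e with KZ1 _ | KH | KB => ~~ o | _ => o end.
Definition kword (e : kind) : morph :=
  match e with
  | KA1 | KA => mk3 [:: l1] [:: l1; l2] [:: l1; l3]
  | KA2 => mk3 [:: l2; l1] [:: l2] [:: l2; l3]
  | KZ1 k => mk3 [:: l1; l2] (l1 :: nseq k l3) (l1 :: nseq k.+1 l3)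
  | KZ2 k => mk3 [:: l2; l1] (l2 :: nseq k l3) (l2 :: nseq k.+1 l3)
  | KH => mk3 [:: l1; l3; l2] [:: l1; l3] [:: l1; l2]
  | KB => mk3 [:: l3; l1] [:: l3] [:: l3; l2; l1]
  | KG => mk3 [:: l2] [:: l2; l1] [:: l2; l1; l3]
  | KD k => mk3 [:: l2] [:: l2, l1 & nseq k l3] [:: l2, l1 & nseq k.+1 l3]
  end.
(** The incidence matrix of the label applied to the induced lengths, written out for linear
    arithmetic; [klenE] compares it with [mul]. *)
Definition klen (e : kind) (lam : 'I_3 -> R) : 'I_3 -> R :=
  let x := lam l1 in let y := lam l2 in let z := lam l3 in
  fun a => match e with
  | KA1 | KA => if a == l1 then x + y + z else if a == l2 then y else z
  | KA2 => if a == l1 then x else if a == l2 then x + y + z else z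
  | KZ1 k => if a == l1 then x + y + z else if a == l2 then x else INR k * y + (INR k + 1) * z
  | KZ2 k => if a == l1 then x else if a == l2 then x + y + z else INR k * y + (INR k + 1) * z
  | KH => if a == l1 then x + y + z else if a == l2 then x + z else x + y
  | KB => if a == l1 then x + z else if a == l2 then z else x + y + z
  | KG => if a == l1 then y + z else if a == l2 then x + y + z else z
  | KD k => if a == l1 then y + z else if a == l2 then x + y + z
            else INR k * y + (INR k + 1) * z
  end.
Definition kpos (e : kind) : Prop :=
  match e with KZ1 k | KZ2 k | KD k => (1 <= k)%N | _ => True end.

Definition mul (f : morph) (lam : 'I_3 -> R) (c : 'I_3) : R :=
  INR (count_mem c (f l1)) * lam l1 + INR (count_mem c (f l2)) * lam l2 +
  INR (count_mem c (f l3)) * lam l3.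

Lemma klenE e lam a : klen e lam a = mul (kword e) lam a.
Proof.
rewrite /mul; case: e => [||k|k|||||k]; elim/ord3_ind: a;
  rewrite /= ?count_nseq ?mul1n ?mul0n ?addn0 ?add0n ?plus_INR ?S_INR /=; try lra.
all: by case: (k) => [|k'] /=; lra.
Qed.

Lemma inT_dec S c x : inT S c x \/ (x < lpt S c \/ lpt S c + len S c <= x).
Proof.
rewrite /inT; case: (Rlt_le_dec x (lpt S c)) => ?; first by right; left.
by case: (Rlt_le_dec x (lpt S c + len S c)) => ?; [left|right; right].
Qed.

Lemma sh_nseq S k b : sh S (nseq k b) = INR k * tr S b.
Proof. by elim: k => [|k IH]; rewrite ?S_INR /= ?IH; lra. Qed.

(** The points of a run lie between its first and its last point, and intervals are convex. *)
Lemma adm_nseq S k b x : inT S b x -> inT S b (x + (INR k - 1) * tr S b) -> adm S x (nseq k b).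
Proof.
have [m] := ubnP k; elim: m k x => [//|m IH] [//|[|k]] x lt_km bx by_; first by split.
split=> //; apply: IH; first exact: lt_km.
- move: bx by_; rewrite /inT !S_INR; have := pos_INR k.
  set d := tr S b; move: (INR k) => i i0.
  case: (Rle_lt_dec 0 d) => d0 h1 h2.
    by have : 0 <= i * d; [apply: Rmult_le_pos|lra].
  have : 0 <= i * - d; [apply: Rmult_le_pos => //; lra|lra].
- by move: by_; rewrite !S_INR /inT; lra.
Qed.

(** The induced lengths are given and the larger system is computed from them, so that one statement
    serves both directions of the theorem. *)
Definition kind_induced e := forall o l lam, (forall a, 0 < lam a) ->
  exists l', induced (vsys (ksrc e) o l (klen e lam)) (kword e)
    (vsys (kdst e) (kflip e o) l' lam) (kletter e).

Ltac calc := rewrite /= /inI /inT /total /tr /bpt /lpt /lend /tri /=.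
(** Tests one tower level, at height [u] over the interval of [c]; failure leaves the inequalities
    excluding it. *)
Ltac cand S S' c u v :=
  match goal with _ : inI S ?x |- _ =>
  let h := fresh "h" in
  case: (inT_dec S' c (x - sh S u)) => [h|h]; [by exists c, u, v; split|];
  move: h; calc => h
  end.
Ltac cands S S' c u v :=
  lazymatch v with
  | nil => idtac
  | ?b :: ?v' => cand S S' c u v; let u' := eval cbv [cat] in (u ++ [:: b]) in cands S S' c u' v'
  end.
Ltac disc f u :=
  exists f, u; split;
  [ by apply: ord3_ind; apply: ord3_ind | by []
  | apply: ord3_ind; first [by case | move=> _; split; [by []|eexists; reflexivity|calc; lra]] ].
Ltac finite_kind w1 w2 w3 :=
  lazymatch goal with |- induced ?S _ ?S' _ => split;
  [ by move=> x; calc; lra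
  | by apply: ord3_ind; eexists; first reflexivity
  | by apply: ord3_ind; calc; lra
  | by apply: ord3_ind => x; calc => h; repeat split; lra
  | by move=> x Ix; cands S S' l1 (@nil 'I_3) w1; cands S S' l2 (@nil 'I_3) w2;
      cands S S' l3 (@nil 'I_3) w3; exfalso;
      match goal with I : inI _ _ |- _ => move: I end; calc; lra
  | ] end.

Lemma induced_A1 : kind_induced KA1.
Proof.
move=> o l lam lam0; exists (lpt (vsys V33 o l (klen KA1 lam)) l1).
have := (lam0 l1, lam0 l2, lam0 l3) => -[[x0 y0] z0].
case: o; finite_kind [:: l1] [:: l1; l2] [:: l1; l3].
- disc (tri l1 l2 l3) (mk3 [:: l1] [::] [:: l1]).
- disc (tri l1 l2 l3) (mk3 [::] [:: l1] [:: l1]).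
Qed.

Lemma induced_A2 : kind_induced KA2.
Proof.
move=> o l lam lam0; exists (lpt (vsys V33 o l (klen KA2 lam)) l2).
have := (lam0 l1, lam0 l2, lam0 l3) => -[[x0 y0] z0].
case: o; finite_kind [:: l2; l1] [:: l2] [:: l2; l3].
- disc (tri l1 l2 l3) (mk3 [:: l2] [::] [:: l2]).
- disc (tri l1 l2 l3) (mk3 [::] [:: l2] [:: l2]).
Qed.

Lemma induced_A : kind_induced KA.
Proof.
move=> o l lam lam0; exists (lpt (vsys V32 o l (klen KA lam)) l1).
have := (lam0 l1, lam0 l2, lam0 l3) => -[[x0 y0] z0].
case: o; finite_kind [:: l1] [:: l1; l2] [:: l1; l3].
- disc (tri l1 l2 l3) (mk3 [::] [:: l1] [:: l1]).
- disc (tri l1 l2 l3) (mk3 [:: l1] [:: l1] [::]).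
Qed.

Lemma induced_H : kind_induced KH.
Proof.
move=> o l lam lam0; exists (lpt (vsys V32 o l (klen KH lam)) l1).
have := (lam0 l1, lam0 l2, lam0 l3) => -[[x0 y0] z0].
case: o; finite_kind [:: l1; l3; l2] [:: l1; l3] [:: l1; l2].
- disc (tri l3 l1 l2) (mk3 [::] [:: l1; l3] [:: l1]).
- disc (tri l2 l3 l1) (mk3 [:: l1; l3] [:: l1] [::]).
Qed.

Lemma induced_B : kind_induced KB.
Proof.
move=> o l lam lam0; exists (lpt (vsys V32 o l (klen KB lam)) l3).
have := (lam0 l1, lam0 l2, lam0 l3) => -[[x0 y0] z0].
case: o; finite_kind [:: l3; l1] [:: l3] [:: l3; l2; l1].
- disc (tri l1 l3 l2) (mk3 [::] [:: l3] [:: l3]).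
- disc (tri l1 l3 l2) (mk3 [:: l3] [:: l3] [::]).
Qed.

Lemma induced_G : kind_induced KG.
Proof.
move=> o l lam lam0; exists (lpt (vsys V32 o l (klen KG lam)) l2).
have := (lam0 l1, lam0 l2, lam0 l3) => -[[x0 y0] z0].
case: o; finite_kind [:: l2] [:: l2; l1] [:: l2; l1; l3].
- disc (tri l2 l1 l3) (mk3 [::] [:: l2] [:: l2; l1]).
- disc (tri l3 l2 l1) (mk3 [:: l2] [:: l2; l1] [::]).
Qed.

Lemma steps_up (s a p : R) : 0 < s -> p < a + s ->
  exists m, a <= p + INR m * s < a + s.
Proof.
move=> s0; have [n] := INR_unbounded ((a - p) / s).
move/(Rmult_gt_compat_r _ _ _ s0); rewrite /Rdiv Rmult_assoc Rinv_l ?Rmult_1_r; last lra.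
elim: n p => [|n IH] p h1 h2; first by exists 0%N; move: h1; rewrite /=; lra.
case: (Rle_lt_dec a p) => h; first by exists 0%N; rewrite /=; lra.
have [||m hm] := IH (p + s); rewrite ?S_INR in h1; try lra.
by exists m.+1; rewrite S_INR; lra.
Qed.

Lemma steps_down (s a p : R) : 0 < s -> a <= p ->
  exists m, a <= p - INR m * s < a + s.
Proof.
move=> s0; have [n] := INR_unbounded ((p - a) / s).
move/(Rmult_gt_compat_r _ _ _ s0); rewrite /Rdiv Rmult_assoc Rinv_l ?Rmult_1_r; last lra.
elim: n p => [|n IH] p h1 h2; first by exists 0%N; move: h1; rewrite /=; lra.
case: (Rle_lt_dec (a + s) p) => h; last by exists 0%N; rewrite /=; lra.
have [||m hm] := IH (p - s); rewrite ?S_INR in h1; try lra.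
by exists m.+1; rewrite S_INR; lra.
Qed.

Lemma steps_lt (s : R) m k : 0 < s -> INR m * s < INR k * s -> (m < k)%N.
Proof. by move=> s0 /(Rmult_lt_reg_r _ _ _ s0) /INR_lt; lia. Qed.

Lemma adm_run S x u k b : adm S x u -> inT S b (x + sh S u) ->
  inT S b (x + sh S u + (INR k - 1) * tr S b) -> adm S x (u ++ nseq k b).
Proof. by move=> au h1 h2; apply/adm_cat; split=> //; apply: adm_nseq. Qed.

Lemma cover_run S S' (f : morph) u b k m s x : 0 < s ->
  f l2 = u ++ nseq k b -> f l3 = u ++ nseq k.+1 b ->
  (inT S' l2 (x - (sh S u + INR m * tr S b)) /\ INR m * s < INR k * s) \/
  (inT S' l3 (x - (sh S u + INR m * tr S b)) /\ INR m * s < INR k * s + s) ->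
  exists c u v, [/\ f c = u ++ v, v <> [::] & inT S' c (x - sh S u)].
Proof.
move=> s0 f2 f3 [[cx lt_mk]|[cx lt_mk]].
  have {}lt_mk := steps_lt s0 lt_mk; exists l2, (u ++ nseq m b), (nseq (k - m) b).
  rewrite sh_cat sh_nseq f2 -catA -nseqD subnKC ?(ltnW lt_mk) //; split=> //.
  by rewrite -(subnSK lt_mk).
have {}lt_mk : (m < k.+1)%N by apply: (steps_lt s0); rewrite S_INR; lra.
exists l3, (u ++ nseq m b), (nseq (k.+1 - m) b).
rewrite sh_cat sh_nseq f3 -catA -nseqD subnKC ?(ltnW lt_mk) //; split=> //.
by rewrite -(subnSK lt_mk).
Qed.

(** For points in a run. The window [[A, A + s)] will be the union of the intervals of [l2] and [l3]
    in [S'], and its length is the size of the translation of [b]. Going back by that translation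
    reaches the window, and the number of steps is the height in the run. *)
Lemma cover_shift S S' (f : morph) u b k s t x A : 0 < s -> t = s \/ t = - s ->
  tr S b = t -> f l2 = u ++ nseq k b -> f l3 = u ++ nseq k.+1 b ->
  (0 < t -> A <= x - sh S u) -> (t < 0 -> x - sh S u < A + s) ->
  (forall i, A <= x - (sh S u + i * t) < A + s ->
    (x - (sh S u + i * t) < lpt S' l2 \/ lpt S' l2 + len S' l2 <= x - (sh S u + i * t) ->
     inT S' l3 (x - (sh S u + i * t)) /\ i * s < INR k * s + s) /\
    (inT S' l2 (x - (sh S u + i * t)) -> i * s < INR k * s)) ->
  exists c u v, [/\ f c = u ++ v, v <> [::] & inT S' c (x - sh S u)].
Proof.
move=> s0 ts et f2 f3 hdown hup hm.
have [m Am] : exists m, A <= x - (sh S u + INR m * t) < A + s.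
  case: ts => e; rewrite e in hdown hup *.
    by have [m h] := steps_down s0 (hdown s0); exists m; lra.
  by have [m h] := steps_up s0 (hup ltac:(lra)); exists m; lra.
have [h3 h2] := hm _ Am; apply: (cover_run (m := m) s0 f2 f3); rewrite et.
by case: (inT_dec S' l2 (x - (sh S u + INR m * t))) => h; [left|right; apply: h3]; auto.
Qed.

(** Points of the interval of [l3] are treated by [cover_shift]; the others lie on a few explicit
    tower levels, tried in turn. *)
Ltac run_kind u k w1 w2 s t A :=
  lazymatch goal with |- induced ?S ?f ?S' _ => split;
  [ by move=> x; calc; lra
  | by apply: ord3_ind; eexists; first reflexivity; rewrite // ?inE ?mem_nseq ?andbF
  | by apply: ord3_ind; rewrite /= ?sh_nseq; calc; lra
  | let h := fresh in apply: ord3_ind => x h;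
    [ by move: h; calc => h; repeat split; lra
    | by apply: (@adm_run _ _ u k l3); move: h; calc => h; repeat split; lra
    | by apply: (@adm_run _ _ u k.+1 l3); move: h; rewrite ?S_INR; calc => h;
        repeat split; lra ]
  | let I := fresh in let x := fresh in let h3 := fresh in intros x I;
    destruct (inT_dec S l3 x) as [h3|h3];
    [ refine (@cover_shift S S' f u l3 k s t x A _ _ _ _ _ _ _ _);
      [ lra | first [by left|by right] | calc; lra | by [] | by []
      | revert h3; calc; lra | revert h3; calc; lra
      | let i := fresh in let h1 := fresh in revert h3; calc; intros h3 i h1; split; lra]
    | cands S S' l1 (@nil 'I_3) w1; w2 S S'; cand S S' l2 (@nil 'I_3) (u ++ nseq k l3);
      cand S S' l3 (@nil 'I_3) (u ++ nseq k.+1 l3);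
      exfalso; revert I h3; calc; lra ]
  | ] end.

Lemma nseqSr k (b : 'I_3) : nseq k.+1 b = nseq k b ++ [:: b].
Proof. by rewrite -[k.+1]addn1 nseqD. Qed.

Ltac run_disc k f u :=
  exists f, u; split;
  [ by apply: ord3_ind; apply: ord3_ind | by []
  | apply: ord3_ind; first [by case | move=> _; split;
    [ by []
    | first [ eexists; reflexivity | by exists [::]; rewrite /= cats0
            | by exists [:: l3]; rewrite /= -nseqSr ]
    | rewrite /= ?sh_nseq; calc; lra]] ].

Section Run.
Variables (k : nat) (k1 : (1 <= k)%N).

Lemma mulk_ge x : 0 < x -> x <= INR k * x.
Proof.
move=> x0; have K1 : 1 <= INR k by apply: (le_INR 1); apply/leP.
by rewrite -{1}[x]Rmult_1_l; apply: Rmult_le_compat_r; lra.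
Qed.

Lemma induced_Z1 : kind_induced (KZ1 k).
Proof.
move=> o l lam lam0; exists (lpt (vsys V33 o l (klen (KZ1 k) lam)) l1).
have := (lam0 l1, lam0 l2, lam0 l3) => -[[x0 y0] z0].
have Ky := mulk_ge y0; have Kz := mulk_ge z0.
case: o.
- run_kind [:: l1] k [:: l1; l2] ltac:(fun S S' => idtac)
    (lam l2 + lam l3) (lam l2 + lam l3)
    (l + lam l1 + (INR k * lam l2 + (INR k + 1) * lam l3) + lam l1).
  run_disc k (tri l2 l1 l3) (mk3 (l1 :: nseq k l3) [::] [:: l1]).
- run_kind [:: l1] k [:: l1; l2] ltac:(fun S S' => idtac)
    (lam l2 + lam l3) (- (lam l2 + lam l3)) l.
  run_disc k (tri l2 l1 l3) (mk3 [::] [:: l1] (l1 :: nseq k l3)).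
Qed.

Lemma induced_Z2 : kind_induced (KZ2 k).
Proof.
move=> o l lam lam0; exists (lpt (vsys V33 o l (klen (KZ2 k) lam)) l2).
have := (lam0 l1, lam0 l2, lam0 l3) => -[[x0 y0] z0].
have Ky := mulk_ge y0; have Kz := mulk_ge z0.
case: o.
- run_kind [:: l2] k [:: l2; l1] ltac:(fun S S' => idtac)
    (lam l2 + lam l3) (- (lam l2 + lam l3)) (l).
  run_disc k (tri l1 l2 l3) (mk3 [:: l2] [::] (l2 :: nseq k l3)).
- run_kind [:: l2] k [:: l2; l1] ltac:(fun S S' => idtac)
    (lam l2 + lam l3) (lam l2 + lam l3)
    (l + lam l1 + (INR k * lam l2 + (INR k + 1) * lam l3) + lam l1).
  run_disc k (tri l1 l2 l3) (mk3 [::] (l2 :: nseq k l3) [:: l2]).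
Qed.

Lemma induced_D : kind_induced (KD k).
Proof.
move=> o l lam lam0; exists (lpt (vsys V32 o l (klen (KD k) lam)) l2).
have := (lam0 l1, lam0 l2, lam0 l3) => -[[x0 y0] z0].
have Ky := mulk_ge y0; have Kz := mulk_ge z0.
case: o.
- run_kind [:: l2; l1] k [:: l2] ltac:(fun S S' =>
    cand S S' l2 [:: l2] (l1 :: nseq k l3); cand S S' l3 [:: l2] (l1 :: nseq k.+1 l3))
    (lam l2 + lam l3) (- (lam l2 + lam l3)) (l + lam l2 + lam l3).
  run_disc k (tri l2 l1 l3) (mk3 [::] [:: l2] [:: l2, l1 & nseq k l3]).
- run_kind [:: l2; l1] k [:: l2] ltac:(fun S S' =>
    cand S S' l2 [:: l2] (l1 :: nseq k l3); cand S S' l3 [:: l2] (l1 :: nseq k.+1 l3))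
    (lam l2 + lam l3) (lam l2 + lam l3) (l + (INR k * lam l2 + (INR k + 1) * lam l3) + lam l1).
  run_disc k (tri l3 l2 l1) (mk3 [:: l2] [:: l2, l1 & nseq k l3] [::]).
Qed.

End Run.

Lemma kindP e : kpos e -> kind_induced e.
Proof.
case: e => [||k|k|||||k] h; [exact: induced_A1|exact: induced_A2|exact: induced_Z1|exact: induced_Z2
 |exact: induced_A|exact: induced_H|exact: induced_B|exact: induced_G|exact: induced_D].
Qed.

(** * Selecting the next edge *)

Lemma division (s z : R) : 0 < s -> 0 < z -> exists k r, z = INR k * s + r /\ 0 <= r < s.
Proof.
move=> s0 z0; have [k hk] := steps_down s0 (Rlt_le _ _ z0).
by exists k, (z - INR k * s); lra.
Qed.

Lemma conn_run S b b' u k c : b <> top S l1 -> b' <> top S l1 ->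
  adm S (lpt S b) u -> (0 < k)%N -> inT S c (lpt S b + sh S u) ->
  inT S c (lpt S b + sh S u + (INR k - 1) * tr S c) ->
  lpt S b' = lpt S b + (sh S u + INR k * tr S c) -> conn S b b' (u ++ nseq k c).
Proof.
move=> b0 b'0 au k0 h1 h2 e; split=> //; last by rewrite sh_cat sh_nseq.
  by case: u {au h1 h2 e} => [|//]; case: k k0.
exact: adm_run.
Qed.

Lemma pos_tri x y z : 0 < x -> 0 < y -> 0 < z -> forall a, 0 < tri x y z a.
Proof. by move=> x0 y0 z0; elim/ord3_ind. Qed.

Ltac connect nc b b' w :=
  exfalso; apply: (nc b b' w); split;
  [by []|by []|by []|calc; repeat split; lra|calc; lra].
Ltac connect_run nc b b' u k c :=
  exfalso; apply: (nc b b' (u ++ nseq k c)); apply: conn_run;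
  [by []|by []|calc; repeat split; lra|by []|calc; lra
  |rewrite !S_INR; calc; lra|rewrite !S_INR; calc; lra].
Ltac select e x y z :=
  exists e, (tri x y z); split;
  [by []|by []|apply: pos_tri; lra|apply: ord3_ind; rewrite /klen ?S_INR /=; lra].

(* Every equality between the lengths being compared produces a connection, so the strict
   inequalities select an edge. *)
Lemma next_kind v o l lam : (forall a, 0 < lam a) -> noconn (vsys v o l lam) ->
  exists e lam', [/\ kpos e, ksrc e = v, forall a, 0 < lam' a & forall a, lam a = klen e lam' a].
Proof.
move=> lam0; have := (lam0 l1, lam0 l2, lam0 l3) => -[[x0 y0] z0] {lam0}.
case: v => nc.
- case: (Rtotal_order (lam l1) (lam l2)) => [xy|[xy|xy]].
  + case: (Rtotal_order (lam l1) (lam l3)) => [xz|[xz|xz]].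
    (* The translation of [l3] has size [lam l1]. The quotient of [lam l3] by it is the exponent of
       the label, and the remainder becomes a length of the next system. *)
    * have [k [r [ez [r0 rs]]]] := division x0 z0.
      case: r0 => r0.
        case: k ez => [|k] ez; first by move: ez; rewrite /=; lra.
        by rewrite S_INR in ez; select (KD k.+1) (lam l2 - lam l1) (lam l1 - r) r.
      (* With remainder zero the quotient is at least 2, and the run of [l3] ends exactly at a
         division point. *)
      subst r; case: k ez => [|[|k]] ez; try by (move: ez; rewrite /=; lra).
      rewrite !S_INR in ez; have k0 := pos_INR k.
      have kx : 0 <= INR k * lam l1 by apply: Rmult_le_pos; lra.
      case: o nc => nc.
        by connect_run nc l2 l3 [:: l2; l1] k.+1 l3.
      by connect_run nc l1 l2 [:: l1] k.+2 l3.
    * by case: o nc => nc; [connect nc l2 l3 [:: l2; l1]|connect nc l1 l2 [:: l1; l3]].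
    * by select KG (lam l2 - lam l1) (lam l1 - lam l3) (lam l3).
  + by case: o nc => nc; [connect nc l3 l2 [:: l3]|connect nc l2 l1 [:: l2]].
  + case: (Rtotal_order (lam l1) (lam l3)) => [xz|[xz|xz]].
    * by select KB (lam l1 - lam l2) (lam l3 - lam l1) (lam l2).
    * by case: o nc => nc; [connect nc l2 l3 [:: l2; l1]|connect nc l1 l2 [:: l1; l3]].
    * case: (Rtotal_order (lam l1) (lam l2 + lam l3)) => [h|[h|h]].
      -- by select KH (lam l2 + lam l3 - lam l1) (lam l1 - lam l2) (lam l1 - lam l3).
      -- by case: o nc => nc; [connect nc l2 l2 [:: l2; l1]|connect nc l1 l1 [:: l1; l3]].
      -- by select KA (lam l1 - lam l2 - lam l3) (lam l2) (lam l3).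
- case: (Rtotal_order (lam l1) (lam l2)) => [xy|[xy|xy]].
  + case: (Rtotal_order (lam l2) (lam l1 + lam l3)) => [h|[h|h]].
    (* At [V33] the translation of [l3] has size [lam l2 - lam l1], or the opposite, and the
       division is by that size. *)
    * have s0 : 0 < lam l2 - lam l1 by lra.
      have [k [r [ez [r0 rs]]]] := division s0 z0.
      case: r0 => r0.
        case: k ez => [|k] ez; first by move: ez; rewrite /=; lra.
        by rewrite S_INR in ez; select (KZ2 k.+1) (lam l1) (lam l2 - lam l1 - r) r.
      subst r; case: k ez => [|[|k]] ez; try by (move: ez; rewrite /=; lra).
      rewrite !S_INR in ez; have k0 := pos_INR k.
      have kx : 0 <= INR k * (lam l2 - lam l1) by apply: Rmult_le_pos; lra.
      case: o nc => nc.
        by connect_run nc l1 l3 [:: l1; l2] k.+1 l3.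
      by connect_run nc l3 l2 (@nil 'I_3) k.+2 l3.
    * by case: o nc => nc; [connect nc l1 l3 [:: l1; l2]|connect nc l3 l2 [:: l3]].
    * by select KA2 (lam l1) (lam l2 - lam l1 - lam l3) (lam l3).
  + by case: o nc => nc; connect nc l3 l3 [:: l3].
  + case: (Rtotal_order (lam l1) (lam l2 + lam l3)) => [h|[h|h]].
    * have s0 : 0 < lam l1 - lam l2 by lra.
      have [k [r [ez [r0 rs]]]] := division s0 z0.
      case: r0 => r0.
        case: k ez => [|k] ez; first by move: ez; rewrite /=; lra.
        by rewrite S_INR in ez; select (KZ1 k.+1) (lam l2) (lam l1 - lam l2 - r) r.
      subst r; case: k ez => [|[|k]] ez; try by (move: ez; rewrite /=; lra).
      rewrite !S_INR in ez; have k0 := pos_INR k.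
      have kx : 0 <= INR k * (lam l1 - lam l2) by apply: Rmult_le_pos; lra.
      case: o nc => nc.
        by connect_run nc l3 l1 (@nil 'I_3) k.+2 l3.
      by connect_run nc l2 l3 [:: l2; l1] k.+1 l3.
    * by case: o nc => nc; [connect nc l3 l1 [:: l3]|connect nc l2 l3 [:: l2; l1]].
    * by select KA1 (lam l1 - lam l2 - lam l3) (lam l2) (lam l3).
Qed.

(** * Labels of the edges and spreading of letters *)

Lemma pi213_run k : flatten (map pi213 (nseq k l3)) = nseq k l3.
Proof. by elim: k => //= k ->. Qed.

(** Multiplying out the renamings turns the labels into the words of [kword], so that paths become
    sequences of kinds. *)
Lemma edgeP v w f : edge v w f <->
  exists e, [/\ kpos e, v = ksrc e, w = kdst e & meq f (kword e)].
Proof.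
have beta_word : meq (Defs.comp pi312 (Defs.comp beta pi213)) (kword KB) by apply: ord3_ind.
have gamma_word : meq (Defs.comp pi213 gamma) (kword KG) by apply: ord3_ind.
have eta_word : meq (Defs.comp pi132 (Defs.comp eta pi321)) (kword KH) by apply: ord3_ind.
have alpha_word : meq (Defs.comp pi213 (Defs.comp alpha pi213)) (kword KA2) by apply: ord3_ind.
have delta_word k : meq (Defs.comp pi213 (delta k)) (kword (KD k)).
  by apply: ord3_ind; rewrite /Defs.comp //= pi213_run.
have zeta1_word k : meq (Defs.comp (zeta k) pi213) (kword (KZ1 k)).
  by apply: ord3_ind; rewrite /Defs.comp //= cats0.
have zeta2_word k : meq (Defs.comp pi213 (Defs.comp (zeta k) pi213)) (kword (KZ2 k)).
  by apply: ord3_ind; rewrite /Defs.comp //= cats0 /= pi213_run.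
have tr f1 f2 f3 : meq f1 f2 -> meq f2 f3 -> meq f1 f3 by move=> h1 h2 a; rewrite h1.
have sy f1 f2 : meq f1 f2 -> meq f2 f1 by move=> h a; rewrite h.
split.
  case: v; case: w => //=.
  - by case=> h; [exists KA|exists KH]; split=> //; apply: tr h _.
  - case=> [h|[h|[k [k0 h]]]]; [exists KB|exists KG|exists (KD k)]; split=> //; exact: tr h _.
  - case=> [h|[h|[k [k0 [h|h]]]]];
      [exists KA1|exists KA2|exists (KZ1 k)|exists (KZ2 k)]; split=> //; exact: tr h _.
case=> -[||k|k|||||k] [k0 -> -> h] /=.
- by left.
- by right; left; apply: tr h (sy _ _ _).
- by right; right; exists k; split=> //; left; apply: tr h (sy _ _ _).
- by right; right; exists k; split=> //; right; apply: tr h (sy _ _ _).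
- by left.
- by right; apply: tr h (sy _ _ _).
- by left; apply: tr h (sy _ _ _).
- by right; left; apply: tr h (sy _ _ _).
- by right; right; exists k; split=> //; apply: tr h (sy _ _ _).
Qed.

Lemma perm_of_inj (f : 'I_3 -> 'I_3) : injective f -> exists p : {perm 'I_3}, forall a, p a = f a.
Proof. by move=> fI; exists (perm fI) => a; rewrite permE. Qed.

Lemma Sigma3_pim a b c : injective (tri a b c) -> in_Sigma3 (pim a b c).
Proof.
move=> fI; have [p hp] := perm_of_inj fI; exists p.
by apply: ord3_ind; rewrite /perm_morph hp.
Qed.

Lemma edge_S3 v w f : edge v w f -> in_Sigma3_S3_Sigma3 f.
Proof.
have sid : in_Sigma3 Defs.idm by exists 1%g => a; rewrite /perm_morph perm1.
have s213 : in_Sigma3 pi213 by apply: Sigma3_pim; apply: ord3_ind; apply: ord3_ind.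
have s312 : in_Sigma3 pi312 by apply: Sigma3_pim; apply: ord3_ind; apply: ord3_ind.
have s132 : in_Sigma3 pi132 by apply: Sigma3_pim; apply: ord3_ind; apply: ord3_ind.
have s321 : in_Sigma3 pi321 by apply: Sigma3_pim; apply: ord3_ind; apply: ord3_ind.
have idl g : meq (Defs.comp Defs.idm g) g
  by move=> a; rewrite /Defs.comp /Defs.idm; apply: flatten_seq1.
have idr g : meq (Defs.comp g Defs.idm) g by move=> a; rewrite /Defs.comp /Defs.idm /= cats0.
have aS : in_S3 alpha by left.
have bS : in_S3 beta by right; left.
have cS : in_S3 gamma by right; right; left.
have eS : in_S3 eta by right; right; right; left.
have dS k : (1 <= k)%N -> in_S3 (delta k) by move=> k1; do 4 right; exists k; split=> //; left.
have zS k : (1 <= k)%N -> in_S3 (zeta k) by move=> k1; do 4 right; exists k; split=> //; right.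
have id2 g : meq (Defs.comp Defs.idm (Defs.comp g Defs.idm)) g by move=> a; rewrite idl idr.
have two g h f' : meq f' (Defs.comp h g) -> meq f' (Defs.comp h (Defs.comp g Defs.idm)).
  by move=> e a; rewrite e /Defs.comp /Defs.idm /= cats0.
have tr f1 f2 f3 : meq f1 f2 -> (forall a, f3 a = f2 a) -> meq f1 f3 by move=> h1 h2 a; rewrite h1.
have mk p s q : in_Sigma3 p -> in_S3 s -> in_Sigma3 q ->
    meq f (Defs.comp p (Defs.comp s q)) -> in_Sigma3_S3_Sigma3 f by exists p, s, q.
case: v; case: w => //=.
- case=> h; last exact: (mk _ _ _ s132 eS s321).
  by apply: (mk _ _ _ sid aS sid); apply: tr h (id2 _).
- case=> [h|[h|[k [k1 h]]]].
  + exact: (mk _ _ _ s312 bS s213).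
  + by apply: (mk _ _ _ s213 cS sid); apply: two.
  + by apply: (mk _ _ _ s213 (dS _ k1) sid); apply: two.
- case=> [h|[h|[k [k1 [h|h]]]]].
  + by apply: (mk _ _ _ sid aS sid); apply: tr h (id2 _).
  + exact: (mk _ _ _ s213 aS s213).
  + by apply: (mk _ _ _ sid (zS _ k1) s213); apply: tr h _ => a; rewrite idl.
  + exact: (mk _ _ _ s213 (zS _ k1) s213).
Qed.

(* Loops keep every stage; those with has1 lead from stage 0 to 1, and those that spread from 1 to
   2 and from 2 to 3. *)
Definition stage (j : nat) (w : seq 'I_3) : bool :=
  match j with
  | 0 => w != [::] | 1 => l1 \in w | 2 => (l1 \in w) && (l2 \in w)
  | _ => [&& l1 \in w, l2 \in w & l3 \in w]
  end.

Definition is_loop (e : kind) : bool := if e is (KB | KG | KD _) then false else true.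
Definition has1 (e : kind) : bool := if e is (KA1 | KZ1 _ | KA | KH) then true else false.
Definition spreads (e : kind) : bool := if e is (KZ1 _ | KZ2 _ | KH) then true else false.

Lemma mem_subst (f : morph) w c d : d \in w -> c \in f d -> c \in flatten (map f w).
Proof. by move=> dw cd; apply/flatten_mapP; exists d. Qed.

Lemma stage3P w : reflect (forall a, a \in w) (stage 3 w).
Proof.
apply: (iffP and3P) => [[h1 h2 h3]|h]; first by apply: ord3_ind.
by split; apply: h.
Qed.

Section Stages.
Variables (e : kind) (w : seq 'I_3).
Hypothesis e0 : kpos e.

Lemma stage_all : stage 3 w -> stage 3 (flatten (map (kword e) w)).
Proof.
move/stage3P => h; apply/stage3P => a.
have [d cd] : exists d, a \in kword e d.
  case: e e0 => [||k|k|||||k] k0; elim/ord3_ind: a;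
  first [by exists l1|by exists l2|by exists l3
    |by exists l3; rewrite /= ?inE ?orbT].
exact: mem_subst (h d) cd.
Qed.

Lemma stage_keep j : is_loop e -> stage j w -> stage j (flatten (map (kword e) w)).
Proof.
move=> le; case: j => [|[|[|j]]] /=; last exact: stage_all.
- by case: w => //= d w' _; case: e le => [||k|k|||||k] //= _; elim/ord3_ind: d.
- by move/mem_subst; apply; case: e le => [||k|k|||||k].
- case/andP=> h1 h2; apply/andP; split.
    by apply: mem_subst h1 _; case: e le => [||k|k|||||k].
  case: e le => [||k|k|||||k] //= _;
  first [by apply: mem_subst h1 _|by apply: mem_subst h2 _].
Qed.

Lemma stage_start : has1 e -> stage 0 w -> stage 1 (flatten (map (kword e) w)).
Proof.
case: w => //= d w' he _; rewrite mem_cat; apply/orP; left.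
by case: e he => [||k|k|||||k] //= _; elim/ord3_ind: d.
Qed.

Lemma stage_spread j : spreads e -> stage j.+1 w -> stage j.+2 (flatten (map (kword e) w)).
Proof.
case: j => [|[|j]] he; last exact: stage_all.
- move=> /= h; case: e he => [||k|k|||||k] //= _; apply/andP; split;
  by apply: mem_subst h _.
- move=> /= /andP[h1 h2]; apply/stage3P; apply: ord3_ind;
  case: e e0 he => [||k|k|||||k] //= k0 _;
  first [by apply: mem_subst h1 _|by apply: mem_subst h2 _
   |by apply: mem_subst h2 _; rewrite /= inE mem_nseq eqxx k0 orbT].
Qed.

End Stages.

(** * Primitivity of infinite paths *)

Lemma not_decreasing_forever (f : nat -> R) (c : R) N : 0 < c ->
  (forall n, (N <= n)%N -> 0 < f n) -> (forall n, (N <= n)%N -> f n.+1 <= f n - c) -> False.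
Proof.
move=> c0 f0 fc; have [k hk] := INR_unbounded (f N / c).
have fk : forall k, f (N + k)%N <= f N - INR k * c.
  elim=> [|m IH]; first by rewrite addn0 /=; lra.
  by rewrite addnS S_INR; have := fc (N + m)%N (leq_addr _ _); lra.
move/(Rmult_gt_compat_r _ _ _ c0): hk; rewrite /Rdiv Rmult_assoc Rinv_l ?Rmult_1_r; last lra.
by have := fk k; have := f0 (N + k)%N (leq_addr _ _); lra.
Qed.

Section KindSequence.
Variables (e : nat -> kind) (s : nat -> morph).
Hypotheses (e_pos : forall n, kpos (e n)) (e_path : forall n, kdst (e n) = ksrc (e n.+1)).
Hypothesis s_word : forall n, meq (s n) (kword (e n)).

Lemma step_word n k a :
  prodm s n k.+1 a = flatten (map (kword (e n)) (prodm s n.+1 k a)).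
Proof. by rewrite /= /Defs.comp (eq_map (s_word n)). Qed.

(** From [V33] there are only loops, and a path that never reaches it consists of loops at [V32]. *)
Lemma eventually_loop : exists N, forall n, (N <= n)%N -> is_loop (e n).
Proof.
case: (classic (exists m, ksrc (e m) = V33)) => [[m hm]|h].
  exists m => n /subnKC <-; elim: (n - m)%N => [|k IH].
    by rewrite addn0; case: (e m) hm.
  have : ksrc (e (m + k.+1)) = V33.
    rewrite addnS -e_path.
    elim: k {IH} => [|k IH]; first by rewrite addn0; case: (e m) hm.
    by rewrite addnS; move: IH; rewrite e_path; case: (e (m + k).+1).
  by case: (e _).
exists 0%N => n _; have : kdst (e n) <> V33 by rewrite e_path => hn; apply: h; exists n.+1.
by case: (e n).
Qed.

Hypothesis inf1 : forall n, exists2 m, (n <= m)%N & has1 (e m).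
Hypothesis inf2 : forall n, exists2 m, (n <= m)%N & spreads (e m).

(** The morphism of largest index acts first. Beyond the last edge that is not a loop, choose
    [m1 < m2 < m3]: the edge [m3] produces [l1], then [m2] and [m1] raise the stage to 3, and the
    loops between keep it. *)
Lemma kind_primitive n : exists2 k, (0 < k)%N & forall b c, c \in prodm s n k b.
Proof.
have [N0 loop] := eventually_loop.
have down j m M b : (N0 <= m)%N -> (m <= M)%N -> forall K, stage j (prodm s M K b) ->
    stage j (prodm s m (M - m + K) b).
  move=> Nm /subnKC <-; move: (M - m)%N => k; rewrite addKn.
  elim: k m Nm => [|k IH] m Nm K; first by rewrite addn0.
  rewrite -addSnnS => /(IH m.+1 (leqW Nm)); rewrite addSn step_word.
  by apply: stage_keep (e_pos m) _ (loop _ Nm).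
have [m1 h1 s1] := inf2 (maxn n N0).
have [m2 h2 s2] := inf2 m1.+1.
have [m3 h3 s3] := inf1 m2.+1.
have Nm1 : (N0 <= m1)%N by apply: leq_trans h1; apply: leq_maxr.
have Nm2 : (N0 <= m2)%N by lia.
have Nm3 : (N0 <= m3)%N by lia.
exists (m1 - n + (m2 - m1 + (m3 - m2 + 1)))%N; first by lia.
move=> b c; apply: (elimT (stage3P _)).
have st1 : stage 1 (prodm s m3 1 b) by rewrite step_word; apply: stage_start.
have st2 : stage 2 (prodm s m2 (m3 - m2 + 1) b).
  have := down 1%N m2.+1 m3 b (leqW Nm2) h3 _ st1.
  rewrite (_ : m3 - m2 + 1 = (m3 - m2.+1 + 1).+1)%N; last by lia.
  by rewrite step_word; apply: stage_spread (e_pos _) _ s2.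
have st3 : stage 3 (prodm s m1 (m2 - m1 + (m3 - m2 + 1)) b).
  have := down 2%N m1.+1 m2 b (leqW Nm1) h2 _ st2.
  rewrite (_ : m2 - m1 + (m3 - m2 + 1) = (m2 - m1.+1 + (m3 - m2 + 1)).+1)%N; last by lia.
  by rewrite step_word; apply: stage_spread (e_pos _) _ s1.
have le_n : (n <= m1)%N by apply: leq_trans h1; apply: leq_maxl.
(* Before [m1] there may be edges that are not loops, but stage 3 survives every edge. *)
move: (m2 - m1 + _)%N st3 => K; move/subnKC: le_n => <-; rewrite addKn.
move: (m1 - n)%N => k; elim: k (n) => [|k IH] m; first by rewrite addn0.
by rewrite -addSnnS => /IH; rewrite addSn step_word; apply: stage_all.
Qed.

End KindSequence.

(** Provides the hypothesis of [inf_often]. The loops [KA2], [KZ2] keep the length of [l1], and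
    [KA], [KA1], [KA2] keep that of [l3], while adding it to another length. *)
Lemma total_klen e lam : (forall a, 0 < lam a) -> is_loop e ->
  (~~ has1 e -> klen e lam l1 = lam l1 /\ total lam <= total (klen e lam) - lam l1) /\
  (~~ spreads e -> klen e lam l3 = lam l3 /\ total lam <= total (klen e lam) - lam l3).
Proof.
move=> lam0; have := (lam0 l1, lam0 l2, lam0 l3) => -[[x0 y0] z0].
rewrite /total; case: e => [||k|k|||||k] //= _; split=> // _; rewrite /klen /=.
all: try by split=> //; lra.
have := pos_INR k => k0; split=> //.
have : 0 <= INR k * lam l2 by apply: Rmult_le_pos; lra.
have : 0 <= INR k * lam l3 by apply: Rmult_le_pos; lra.
lra.
Qed.

Section Lengths.
Variables (e : nat -> kind) (lam : nat -> 'I_3 -> R).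
Hypotheses (e_path : forall n, kdst (e n) = ksrc (e n.+1)).
Hypotheses (lam_gt0 : forall n a, 0 < lam n a).
Hypotheses (lamE : forall n a, lam n a = klen (e n) (lam n.+1) a).

Let total_gt0 n : 0 < total (lam n).
Proof. by rewrite /total; move: (lam_gt0 n l1) (lam_gt0 n l2) (lam_gt0 n l3); lra. Qed.

Let totalE n : total (lam n) = total (klen (e n) (lam n.+1)).
Proof. by rewrite /total -!lamE. Qed.

(* Along edges outside good, the length of c would be constant and subtracted from the total. *)
Lemma inf_often (good : kind -> bool) (c : 'I_3) :
  (forall e lam, (forall a, 0 < lam a) -> is_loop e -> ~~ good e ->
    klen e lam c = lam c /\ total lam <= total (klen e lam) - lam c) ->
  forall n, exists2 m, (n <= m)%N & good (e m).
Proof.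
move=> H n; apply: NNPP => h; have [N loop] := eventually_loop e_path.
have step m : (maxn n N <= m)%N ->
    lam m c = lam m.+1 c /\ total (lam m.+1) <= total (lam m) - lam m.+1 c.
  rewrite geq_max => /andP[nm Nm]; rewrite (lamE m) (totalE m).
  by apply: H (lam_gt0 _) (loop _ Nm) _; apply/negP => he; apply: h; exists m.
apply: (@not_decreasing_forever (fun m => total (lam m)) (lam (maxn n N) c) (maxn n N)) => // m hm.
have [_ h2] := step m hm; apply: Rle_trans h2 _; apply: Req_le; congr (_ - _).
move/subnKC: hm => <-; elim: (m - _)%N => [|k IH].
  by rewrite addn0 -(proj1 (step _ (leqnn _))).
by rewrite addnS -(proj1 (step _ _)) // leqW // leq_addr.
Qed.

Lemma inf_has1 n : exists2 m, (n <= m)%N & has1 (e m).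
Proof.
by apply: (inf_often (c := l1)) => k lam' lam0 /(total_klen lam0)[].
Qed.

Lemma inf_spreads n : exists2 m, (n <= m)%N & spreads (e m).
Proof.
by apply: (inf_often (c := l3)) => k lam' lam0 /(total_klen lam0)[].
Qed.

End Lengths.

(** * Existence of length vectors *)

(** An ultrafilter gives limits at all levels at once, without extracting subsequences. *)
Record free_ultrafilter (G : (nat -> Prop) -> Prop) : Prop := FreeUltrafilter {
  fu_up : forall A B : nat -> Prop, (forall n, A n -> B n) -> G A -> G B;
  fu_and : forall A B : nat -> Prop, G A -> G B -> G (fun n => A n /\ B n);
  fu_dec : forall A : nat -> Prop, G A \/ G (fun n => ~ A n);
  fu_ex : forall A : nat -> Prop, G A -> exists n, A n;
  fu_tail : forall N, G (fun n => (N <= n)%N) }.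

Lemma free_ultrafilter_ex : exists G, free_ultrafilter G.
Proof.
have [G [GU sub]] := @filter.ultraFilterLemma _ filter.eventually (filter.eventually_filter).
have GP := @filter.ultra_proper _ _ GU; have GF := @filter.filter_filter _ _ GP.
exists G; split.
- by move=> A B AB; apply: filter.filterS AB.
- by move=> A B; apply: filter.filterI.
- by move=> A; apply: filter.in_ultra_setVsetC.
- by move=> A /filter.filter_ex.
- by move=> N; apply: sub; exists N.
Qed.

Section UltraLimit.
Variable G : (nat -> Prop) -> Prop.
Hypothesis GU : free_ultrafilter G.

Definition ulim (u : nat -> R) (x : R) : Prop :=
  forall eps, 0 < eps -> G (fun n => Rabs (u n - x) < eps).

(** The limit is the supremum of the numbers below [u n] for a large set of [n]; a number above the
    supremum fails on a large set because [G] decides every set. *)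
Lemma ulim_ex u : (forall n, 0 <= u n <= 1) -> exists x, ulim u x.
Proof.
move=> u01; pose E x := G (fun n => x <= u n).
have E0 : E 0 by apply: (fu_up GU) (fu_tail GU 0) => n _; case: (u01 n).
have E1 : is_upper_bound E 1.
  by move=> x /(fu_ex GU)[n]; have := u01 n; lra.
have [x [ub lub]] := completeness E (ex_intro _ _ E1) (ex_intro _ _ E0).
exists x => eps eps0.
have [y [Ey xy]] : exists y, E y /\ x - eps < y.
  apply: NNPP => h; have := lub (x - eps); case/(_ _)/Rle_not_lt; last lra.
  by move=> y Ey; apply: Rnot_lt_le => xy; apply: h; exists y.
have nE : G (fun n => ~ (x + eps / 2 <= u n)).
  case: (fu_dec GU (fun n => x + eps / 2 <= u n)) => // /ub; lra.
by apply: (fu_up GU) (fu_and GU Ey nE) => n [h1 h2]; apply: Rabs_def1; lra.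
Qed.

Lemma ulim_add u v x y : ulim u x -> ulim v y -> ulim (fun n => u n + v n) (x + y).
Proof.
move=> ux vy eps eps0; have e2 : 0 < eps / 2 by lra.
apply: (fu_up GU) (fu_and GU (ux _ e2) (vy _ e2)) => n [h1 h2].
have := Rabs_triang (u n - x) (v n - y).
by rewrite (_ : u n - x + (v n - y) = u n + v n - (x + y)); lra.
Qed.

Lemma ulim_scale u x c : 0 <= c -> ulim u x -> ulim (fun n => c * u n) (c * x).
Proof.
move=> c0 ux eps eps0; have e2 : 0 < eps / (c + 1) by apply: Rdiv_lt_0_compat; lra.
apply: (fu_up GU) (ux _ e2) => n h.
rewrite -Rmult_minus_distr_l Rabs_mult (Rabs_pos_eq c) //.
have := Rabs_pos (u n - x) => a0.
have := Rmult_lt_compat_r (c + 1) _ _ ltac:(lra) h.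
by rewrite /Rdiv Rmult_assoc Rinv_l ?Rmult_1_r; lra.
Qed.

Lemma ulim_unique u v x y N : (forall n, (N <= n)%N -> u n = v n) ->
  ulim u x -> ulim v y -> x = y.
Proof.
move=> uv ux vy; apply: cond_eq => eps eps0; have e2 : 0 < eps / 2 by lra.
have [n [Nn [h1 h2]]] := fu_ex GU (fu_and GU (fu_tail GU N) (fu_and GU (ux _ e2) (vy _ e2))).
rewrite -(uv _ Nn) in h2; have := Rabs_triang (x - u n) (u n - y).
rewrite (Rabs_minus_sym x) (_ : x - u n + (u n - y) = x - y); lra.
Qed.

Lemma ulim_ge0 u x : (forall n, 0 <= u n) -> ulim u x -> 0 <= x.
Proof.
move=> u0 ux; apply: Rnot_lt_le => x0; have [|n] := fu_ex GU (ux (- x) _); first by lra.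
by have := u0 n; move=> ? /Rabs_def2; lra.
Qed.

Lemma ulim_const c : ulim (fun=> c) c.
Proof.
move=> eps eps0; apply: (fu_up GU) (fu_tail GU 0) => n _.
by rewrite Rminus_diag Rabs_R0.
Qed.

End UltraLimit.

Lemma INR_addn m n : INR (m + n)%N = INR m + INR n.
Proof. exact: plus_INR. Qed.

Lemma count_cons c a (w : seq 'I_3) :
  INR (count_mem c (a :: w)) = (if a == c then 1 else 0) + INR (count_mem c w).
Proof. by rewrite [count_mem _ _]/= INR_addn; case: (a == c). Qed.

Lemma count_subst (f : morph) c w : INR (count_mem c (flatten (map f w))) =
  INR (count_mem c (f l1)) * INR (count_mem l1 w) +
  INR (count_mem c (f l2)) * INR (count_mem l2 w) +
  INR (count_mem c (f l3)) * INR (count_mem l3 w).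
Proof.
elim: w => [|a w IH]; first by rewrite /=; lra.
rewrite [flatten _]/= count_cat INR_addn IH.
by rewrite !count_cons; elim/ord3_ind: a => /=; lra.
Qed.

Lemma mul_comp f g lam c : mul (Defs.comp f g) lam c = mul f (mul g lam) c.
Proof. by rewrite /mul /Defs.comp !count_subst; ring. Qed.

Lemma mul_ext f g lam lam' c : meq f g -> (forall a, lam a = lam' a) -> mul f lam c = mul g lam' c.
Proof. by move=> fg e; rewrite /mul !fg !e. Qed.

Lemma mul_idm lam c : mul Defs.idm lam c = lam c.
Proof. by rewrite /mul; elim/ord3_ind: c => /=; lra. Qed.

Lemma count_ge1 c (w : seq 'I_3) : c \in w -> 1 <= INR (count_mem c w).
Proof. by rewrite -has_pred1 has_count => h; apply: (le_INR 1); apply/leP. Qed.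

Lemma mul_ge0 f lam c : (forall a, 0 <= lam a) -> 0 <= mul f lam c.
Proof.
move=> lam0; have := (Rmult_le_pos _ _ (pos_INR (count_mem c (f l1))) (lam0 l1),
  Rmult_le_pos _ _ (pos_INR (count_mem c (f l2))) (lam0 l2),
  Rmult_le_pos _ _ (pos_INR (count_mem c (f l3))) (lam0 l3)) => -[[]].
by rewrite /mul; lra.
Qed.

Lemma mul_full f lam c : (forall a, 0 <= lam a) -> (forall b, c \in f b) ->
  total lam <= mul f lam c.
Proof.
move=> lam0 cf; have h b : lam b <= INR (count_mem c (f b)) * lam b.
  by rewrite -{1}[lam b]Rmult_1_l; apply: Rmult_le_compat_r; [|exact: count_ge1].
by rewrite /mul /total; have := (h l1, h l2, h l3) => -[[]]; lra.
Qed.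

Lemma mul_prodm (s : nat -> morph) (lam : nat -> 'I_3 -> R) n k c :
  (forall n a, lam n a = mul (s n) (lam n.+1) a) -> lam n c = mul (prodm s n k) (lam (n + k)%N) c.
Proof.
move=> lamE; elim: k n c => [|k IH] n c; first by rewrite addn0 mul_idm.
by rewrite /= mul_comp lamE; apply: mul_ext => // a; rewrite addnS -addSn.
Qed.

Definition primitive_from (s : nat -> morph) : Prop :=
  forall n, exists2 k, (0 < k)%N & forall b c, c \in prodm s n k b.

(** Across a block in which all letters occur, each length is at least the later total. If totals
    stayed above [eps], each block would lower the total by at least [eps]. *)
Lemma chain_shrink (s : nat -> morph) (lam : nat -> 'I_3 -> R) :
  primitive_from s -> (forall n a, 0 < lam n a) ->
  (forall n a, lam n a = mul (s n) (lam n.+1) a) ->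
  forall eps, 0 < eps -> exists N, total (lam N) < eps.
Proof.
move=> prim lam0 lamE eps eps0; apply: NNPP => h.
have ge N : eps <= total (lam N) by apply: Rnot_lt_le => hN; apply: h; exists N.
have desc j : exists N, total (lam N) <= total (lam 0%N) - INR j * eps.
  elim: j => [|j [N hN]]; first by exists 0%N; rewrite /=; lra.
  have [k _ hk] := prim N; exists (N + k)%N; rewrite S_INR.
  have full c : total (lam (N + k)%N) <= lam N c.
    rewrite (mul_prodm N k c lamE); apply: mul_full => // a.
    by have := lam0 (N + k)%N a; lra.
  have := (full l1, full l2, full l3) => -[[h1 h2] h3].
  by have := ge (N + k)%N; move: hN; rewrite {1}/total; lra.
have [j hj] := INR_unbounded (total (lam 0%N) / eps); have [N hN] := desc j.
move/(Rmult_gt_compat_r _ _ _ eps0): hj; rewrite /Rdiv Rmult_assoc Rinv_l ?Rmult_1_r; last lra.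
by have := ge N; lra.
Qed.

Lemma mul_total_le f lam : (forall a, 0 <= lam a) -> (forall b, f b <> [::]) ->
  total lam <= total (mul f lam).
Proof.
move=> lam0 f0.
have h b : lam b <= INR (count_mem l1 (f b)) * lam b + INR (count_mem l2 (f b)) * lam b
    + INR (count_mem l3 (f b)) * lam b.
  have g c : 0 <= INR (count_mem c (f b)) * lam b by apply: Rmult_le_pos => //; apply: pos_INR.
  have := (g l1, g l2, g l3) => -[[g1 g2] g3].
  case: (f b) (f0 b) g1 g2 g3 => [//|a w] _.
  have hm c : 0 <= INR (count_mem c w) * lam b by apply: Rmult_le_pos => //; apply: pos_INR.
  have := (hm l1, hm l2, hm l3) => -[[]].
  by rewrite !count_cons; elim/ord3_ind: a => /=; lra.
by rewrite /total /mul; have := (h l1, h l2, h l3) => -[[]]; lra.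
Qed.

(* At all levels n simultaneously, take the limit along an ultrafilter in N of the normalised
   vectors M_n ... M_(N-1) (1,1,1). *)
Lemma lengths_ex (s : nat -> morph) : primitive_from s -> (forall n b, s n b <> [::]) ->
  exists lam : nat -> 'I_3 -> R,
    (forall n a, 0 < lam n a) /\ forall n a, lam n a = mul (s n) (lam n.+1) a.
Proof.
move=> prim s0; have [G GU] := free_ultrafilter_ex.
pose V N n := mul (prodm s n (N - n)) (fun=> 1).
have V0 N n a : 0 <= V N n a by apply: mul_ge0 => _; lra.
have VE N n a : (n < N)%N -> V N n a = mul (s n) (V N n.+1) a.
  by move=> nN; rewrite /V -(subnSK nN) /= mul_comp.
have V_le N n : (n <= N)%N -> total (V N n) <= total (V N 0%N).
  elim: n => [|n IH] nN; first exact: Rle_refl.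
  apply: Rle_trans (IH (ltnW nN)); rewrite [X in _ <= X]/total !(VE _ _ _ nN).
  by apply: mul_total_le.
have Z0 N : 0 < total (V N 0%N).
  apply: Rlt_le_trans (V_le N N (leqnn _)).
  by rewrite /total /V subnn /= !mul_idm; lra.
(* All levels are divided by the same number, so the linear relations survive. The default 0
   concerns only [N < n], which the limit ignores. *)
pose U n a N := if (n <= N)%N then / total (V N 0%N) * V N n a else 0.
have Uab n a N : 0 <= U n a N <= 1.
  rewrite /U; case: ifP => nN; last by lra.
  have iZ : 0 < / total (V N 0%N) by apply: Rinv_0_lt_compat.
  split; first by apply: Rmult_le_pos; [lra|].
  rewrite -[X in _ <= X](Rinv_l (total (V N 0%N))); last by have := Z0 N; lra.
  apply: Rmult_le_compat_l; first by lra.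
  apply: Rle_trans (V_le _ _ nN); rewrite /total.
  by have := (V0 N n l1, V0 N n l2, V0 N n l3) => -[[]]; elim/ord3_ind: a; lra.
pose lam n a := proj1_sig (constructive_indefinite_description _ (ulim_ex GU (Uab n a))).
have lim n a : ulim G (U n a) (lam n a) by rewrite /lam; case: constructive_indefinite_description.
have lamE n a : lam n a = mul (s n) (lam n.+1) a.
  pose W N := mul (s n) (fun b => U n.+1 b N) a.
  apply: (@ulim_unique G GU (U n a) W _ _ n.+1); last first.
  - by apply: ulim_add => //; [apply: ulim_add => //|]; apply: ulim_scale => //; apply: pos_INR.
  - exact: lim.
  - move=> N nN; rewrite /W /U (ltnW nN) nN VE // /mul; ring.
have lam_ge0 n a : 0 <= lam n a by apply: (ulim_ge0 GU) (lim n a) => N; case: (Uab n a N).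
have lam_total : total (lam 0%N) = 1.
  apply: (@ulim_unique G GU (fun N => U 0%N l1 N + U 0%N l2 N + U 0%N l3 N) (fun=> 1) _ _ 0%N).
  - move=> N _; rewrite /U /= -!Rmult_plus_distr_l Rinv_l //; by have := Z0 N; lra.
  - by apply: ulim_add => //; apply: ulim_add.
  - exact: ulim_const.
(* A vector vanishing at one level would vanish at level 0, where the total is 1. *)
have total_gt0 n : 0 < total (lam n).
  apply: Rnot_le_lt => h.
  have z a : lam n a = 0.
    by move: h; rewrite /total; have := (lam_ge0 n l1, lam_ge0 n l2, lam_ge0 n l3) => -[[]];
      elim/ord3_ind: a; lra.
  have z0 a : lam 0%N a = 0 by rewrite (mul_prodm 0 n a lamE) add0n /mul !z; lra.
  by move: lam_total; rewrite /total !z0; lra.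
exists lam; split=> // n a; have [k _ hk] := prim n.
apply: Rlt_le_trans (total_gt0 (n + k)%N) _; rewrite (mul_prodm n k a lamE).
by apply: mul_full.
Qed.

(** * Assembling the directive sequence *)

Lemma prodm_dirseq (p : {perm 'I_3}) (sigma s : nat -> morph) n k a :
  (forall n, meq (sigma n) (s n)) -> prodm (dirseq p sigma) n.+1 k a = prodm s n k a.
Proof.
move=> e; elim: k n => //= k IH n.
by rewrite /Defs.comp IH (eq_map (e n)).
Qed.

Lemma prodm_dirseq0 (p : {perm 'I_3}) (sigma s : nat -> morph) k a :
  (forall n, meq (sigma n) (s n)) -> prodm (dirseq p sigma) 0 k.+1 a = map p (prodm s 0 k a).
Proof.
move=> e; rewrite /= /Defs.comp (prodm_dirseq p 0 k a e).
by elim: (prodm s 0 k a) => //= b w ->.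
Qed.

Lemma primitive_dirseq p sigma s : (forall n, meq (sigma n) (s n)) ->
  primitive_dir (dirseq p sigma) <-> primitive_from s.
Proof.
move=> e; split=> prim n.
  have [N [lt_nN hN]] := prim n.+1; exists (N - n.+1)%N; first by rewrite subn_gt0.
  by move=> b c; rewrite -(prodm_dirseq p n _ b e).
case: n => [|n].
  have [k k0 hk] := prim 0%N; exists k.+1; split=> // b c.
  by rewrite subn0 (prodm_dirseq0 p k b e) -[c](permKV p) mem_map //; apply: perm_inj.
have [k k0 hk] := prim n; exists (n.+1 + k)%N; split=> [|b c].
  by rewrite -[X in (X < _)%N]addn0 ltn_add2l.
by rewrite addKn (prodm_dirseq p n k b e).
Qed.

Lemma S_adic_dirseq (p : {perm 'I_3}) sigma s x : (forall n, meq (sigma n) (s n)) ->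
  S_adic_shift (dirseq p sigma) x <->
  forall i m, exists N c, infix (map (p^-1)%g (factor x i m)) (prodm s 0 N c).
Proof.
move=> e; split=> h i m; have [N [c hN]] := h i m.
  case: N hN => [|N] /infixP[u [v]].
    (* The empty product is a single letter, and remains one after renaming. *)
    move/(congr1 (map (p^-1)%g)); rewrite !map_cat /= => euv; exists 0%N, ((p^-1)%g c).
    rewrite [prodm _ _ _ _]/= /Defs.idm euv; apply/infixP.
    by exists (map (p^-1)%g u), (map (p^-1)%g v).
  rewrite (prodm_dirseq0 p N c e) => /(congr1 (map (p^-1)%g)).
  rewrite !map_cat mapK; last exact: permK.
  by move=> euv; exists N, c; apply/infixP; exists (map (p^-1)%g u), (map (p^-1)%g v).
case/infixP: hN => u [v /(congr1 (map p))]; rewrite !map_cat mapK; last exact: permKV.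
move=> euv; exists N.+1, c; rewrite (prodm_dirseq0 p N c e).
by apply/infixP; exists (map p u), (map p v).
Qed.

(** Common end of both directions: primitivity makes the intervals shrink, and then [chain_language]
    identifies the two languages. *)
Lemma coding_S_adic l r lam (p0 p1 q : {perm 'I_3}) (S : nat -> sys) (s : nat -> morph) a sigma x :
  (forall n, wf (S n)) -> (forall n, induced (S n) (s n) (S n.+1) (a n)) ->
  (forall n c, len (S n) c = mul (s n) (len (S n.+1)) c) ->
  primitive_from s -> (forall n, meq (sigma n) (s n)) ->
  (forall i, p0 i = q (top (S 0%N) i)) -> (forall i, p1 i = q (bot (S 0%N) i)) ->
  lft (S 0%N) = l -> (forall a, len (S 0%N) a = lam (q a)) -> Rsum predT lam = r - l ->
  natural_coding l r lam p0 p1 x <-> S_adic_shift (dirseq q sigma) x.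
Proof.
move=> wfS indS lenS prim es e0 e1 el elen er.
rewrite (S_adic_dirseq q x es) (coding_lang (wfS 0%N) e0 e1 el elen x er).
have len0 n c : 0 < len (S n) c by case: (wfS n).
have shrink := chain_shrink prim len0 lenS.
by split=> h i m; apply/(chain_language wfS indS shrink); apply: h.
Qed.

(** Renaming makes the upper order the identity, leaving six lower orders [b]. The three reducible
    ones have a one-step connection; the others are renamed orders of a vertex. *)
Lemma vertex_of_regular l lam (p0 p1 : {perm 'I_3}) : (forall a, 0 < lam a) ->
  regular l lam p0 p1 -> exists (v : vertex) (o : bool) (q : {perm 'I_3}),
    (forall i, p0 i = q (vtop v o i)) /\ (forall i, p1 i = q (vbot v o i)).
Proof.
move=> lam0 reg; pose b i := (p0^-1)%g (p1 i).
have bI : injective b by move=> i j /perm_inj/perm_inj.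
have pb i : p1 i = p0 (b i) by rewrite /b permKV.
have wfS : wf (Sys id b l (fun a => lam (p0 a))).
  by split=> [i j|i j|a] /=; [|apply: bI|apply: lam0].
have nc := regular_noconn wfS (q := p0) (fun=> erefl) pb erefl (fun=> erefl) reg.
have := (lam0 (p0 l1), lam0 (p0 l2), lam0 (p0 l3)) => -[[x0 y0] z0].
have relabel v o g : cancel (vtop v o) g -> injective g -> (forall i, b i = g (vbot v o i)) ->
    exists (v : vertex) (o : bool) (q : {perm 'I_3}),
    (forall i, p0 i = q (vtop v o i)) /\ (forall i, p1 i = q (vbot v o i)).
  move=> gK gI eb; have [q hq] := @perm_of_inj (fun a => p0 (g a)) (inj_comp perm_inj gI).
  by exists v, o, q; split=> i; rewrite hq ?gK // pb eb.
have vals f : b l1 = f l1 -> b l2 = f l2 -> b l3 = f l3 -> forall i, b i = f i.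
  by move=> h1 h2 h3; elim/ord3_ind.
clearbody b.
have cases a : [\/ a = l1, a = l2 | a = l3]
  by elim/ord3_ind: a; [constructor 1|constructor 2|constructor 3].
have n12 : b l1 <> b l2 by move/bI.
have n13 : b l1 <> b l3 by move/bI.
have n23 : b l2 <> b l3 by move/bI.
case: (cases (b l1)) => e1; case: (cases (b l2)) => e2; case: (cases (b l3)) => e3;
  try (by case: n12; rewrite e1 e2); try (by case: n13; rewrite e1 e3);
  try (by case: n23; rewrite e2 e3).
- exfalso; apply: (nc l2 l2 [:: l2]); split=> //; calc; rewrite ?e1 ?e2 ?e3 /=; repeat split; lra.
- exfalso; apply: (nc l3 l2 [:: l3]); split=> //; calc; rewrite ?e1 ?e2 ?e3 /=; repeat split; lra.
- exfalso; apply: (nc l3 l3 [:: l3]); split=> //; calc; rewrite ?e1 ?e2 ?e3 /=; repeat split; lra.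
- apply: (relabel V32 true id) => //; first by apply: ord3_ind.
  exact: vals.
- apply: (relabel V32 false (tri l3 l2 l1));
    [by apply: ord3_ind|by apply: ord3_ind; apply: ord3_ind|exact: vals].
- apply: (relabel V33 false (tri l1 l3 l2));
    [by apply: ord3_ind|by apply: ord3_ind; apply: ord3_ind|exact: vals].
Qed.

Record state := State { st_v : vertex; st_o : bool; st_l : R; st_len : 'I_3 -> R }.
Definition st_sys (t : state) : sys := vsys (st_v t) (st_o t) (st_l t) (st_len t).
Definition st_good (t : state) : Prop := (forall a, 0 < st_len t a) /\ noconn (st_sys t).
Definition st_step (t : state) (e : kind) (t' : state) : Prop :=
  [/\ kpos e, ksrc e = st_v t, kdst e = st_v t', st_good t' &
   (forall a, st_len t a = klen e (st_len t') a) /\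
   induced (st_sys t) (kword e) (st_sys t') (kletter e)].

Lemma state_next t : st_good t -> exists p : kind * state, st_step t p.1 p.2.
Proof.
case=> lam0 nc; have [e [lam' [e0 es lam'0 elam]]] := next_kind lam0 nc.
have [l' ind] := kindP e0 (st_o t) (st_l t) lam'0.
exists (e, State (kdst e) (kflip e (st_o t)) l' lam'); split=> //=.
  split=> // b b' w c.
  have ind' : induced (st_sys t) (kword e) (vsys (kdst e) (kflip e (st_o t)) l' lam') (kletter e).
    by rewrite /st_sys -es (functional_extensionality _ _ elam).
  have [c1 [c2 [w' c']]] := conn_lift (vsys_wf _ _ _ lam'0) ind' c.
  exact: nc c'.
by split=> //; rewrite /st_sys -es (functional_extensionality _ _ elam).
Qed.

Lemma state_sequence t : st_good t -> exists (ts : nat -> state) (e : nat -> kind),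
  ts 0%N = t /\ forall n, st_good (ts n) /\ st_step (ts n) (e n) (ts n.+1).
Proof.
move=> t0.
have next u : exists p : kind * state, st_good u -> st_step u p.1 p.2.
  case: (classic (st_good u)) => [/state_next[p hp]|h]; first by exists p.
  (* Arbitrary value for states that never occur. *)
  by exists (KA, u).
pose f u := proj1_sig (constructive_indefinite_description _ (next u)).
have hf u : st_good u -> st_step u (f u).1 (f u).2.
  by rewrite /f; case: constructive_indefinite_description.
pose ts n := iter n (fun u => (f u).2) t.
have good n : st_good (ts n) by elim: n => //= n /hf[].
by exists ts, (fun n => (f (ts n)).1); split=> // n; split=> //; apply: hf.
Qed.

Theorem theorem6p11 (X : (Z -> 'I_3) -> Prop) (HX : shift_space X) :
  is_natural_coding_regular_IET X <->
  exists (p0 : {perm 'I_3}) (sigma : nat -> morph) (v : nat -> vertex),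
    (forall n, in_Sigma3_S3_Sigma3 (sigma n)) /\
    (forall n, edge (v n) (v n.+1) (sigma n)) /\
    primitive_dir (dirseq p0 sigma) /\
    (forall x, X x <-> S_adic_shift (dirseq p0 sigma) x).
Proof.
split.
  case=> l [r [lam [p0 [p1 [lam0 [er [reg XE]]]]]]].
  have [v [o [q [e0 e1]]]] := vertex_of_regular lam0 reg.
  pose t := State v o l (fun a => lam (q a)).
  have wft : wf (st_sys t) by apply: vsys_wf => a; apply: lam0.
  have good : st_good t.
    by split=> [a|] /=; [apply: lam0|apply: (regular_noconn wft e0 e1 erefl (fun=> erefl) reg)].
  have [ts [e [ts0 hts]]] := state_sequence good.
  have e_pos n : kpos (e n) by case: (hts n) => _ [].
  have e_src n : ksrc (e n) = st_v (ts n) by case: (hts n) => _ [].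
  have e_dst n : kdst (e n) = st_v (ts n.+1) by case: (hts n) => _ [].
  have e_path n : kdst (e n) = ksrc (e n.+1) by rewrite e_dst e_src.
  have len0 n a : 0 < st_len (ts n) a by case: (hts n) => -[].
  have lenE n a : st_len (ts n) a = klen (e n) (st_len (ts n.+1)) a.
    by case: (hts n) => _ [_ _ _ _ []].
  have ind n : induced (st_sys (ts n)) (kword (e n)) (st_sys (ts n.+1)) (kletter (e n)).
    by case: (hts n) => _ [_ _ _ _ []].
  have ed n : edge (st_v (ts n)) (st_v (ts n.+1)) (kword (e n)).
    by apply/edgeP; exists (e n); split.
  have prim : primitive_from (fun n => kword (e n)).
    move=> n; apply: (kind_primitive e_pos e_path) => // m.
      exact: (inf_has1 e_path len0 lenE).
    exact: (inf_spreads e_path len0 lenE).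
  exists q, (fun n => kword (e n)), (fun n => st_v (ts n)); split; [|split; [|split]] => //.
  - by move=> n; apply: edge_S3 (ed n).
  - exact/(@primitive_dirseq q _ (fun n => kword (e n))).
  - move=> x; rewrite XE.
    apply: (@coding_S_adic l r lam p0 p1 q (fun n => st_sys (ts n)) (fun n => kword (e n))
      (fun n => kletter (e n))) => //; rewrite ?ts0 //.
    + by move=> n; apply: vsys_wf.
    + by move=> n c; rewrite /= lenE klenE.
case=> p0 [sigma [v [_ [ed [prim XE]]]]].
have /(_ _)/edgeP ed' := ed.
pose e n := proj1_sig (constructive_indefinite_description _ (ed' n)).
have he n : [/\ kpos (e n), v n = ksrc (e n), v n.+1 = kdst (e n) & meq (sigma n) (kword (e n))].
  by rewrite /e; case: constructive_indefinite_description.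
pose s n := kword (e n).
have es n : meq (sigma n) (s n) by case: (he n).
have prim' : primitive_from s by apply/(primitive_dirseq p0 es).
have [lam [lam0 lamE]] : exists lam : nat -> 'I_3 -> R,
    (forall n a, 0 < lam n a) /\ forall n a, lam n a = mul (s n) (lam n.+1) a.
  apply: lengths_ex => // n b; rewrite /s.
  by case: (e n) => [||k|k|||||k]; elim/ord3_ind: b.
have next n (ol : bool * R) : exists l', induced (vsys (v n) ol.1 ol.2 (lam n)) (s n)
    (vsys (v n.+1) (kflip (e n) ol.1) l' (lam n.+1)) (kletter (e n)).
  have [e0 -> -> _] := he n; have [l' h] := kindP e0 ol.1 ol.2 (lam0 n.+1).
  exists l'; rewrite (functional_extensionality (lam n) (klen (e n) (lam n.+1))) // => a.
  by rewrite lamE klenE.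
pose f n ol := (kflip (e n) ol.1, proj1_sig (constructive_indefinite_description _ (next n ol))).
(* Orientation and left endpoint are free at level 0 and then follow the edges. *)
pose ol := fix ol n : bool * R := if n is m.+1 then f m (ol m) else (false, 0).
pose S n := vsys (v n) (ol n).1 (ol n).2 (lam n).
have wfS n : wf (S n) by apply: vsys_wf.
have ind n : induced (S n) (s n) (S n.+1) (kletter (e n)).
  by rewrite /S /= /f; case: constructive_indefinite_description.
have [tI bI _] := wfS 0%N.
have [q0 e0] := perm_of_inj (inj_comp (@perm_inj _ p0) tI).
have [q1 e1] := perm_of_inj (inj_comp (@perm_inj _ p0) bI).
(* Letters of the exchange are named through [p0], the first morphism of the directive sequence. *)
pose lam' a := lam 0%N ((p0^-1)%g a).
have el a : len (S 0%N) a = lam' (p0 a) by rewrite /lam' permK.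
exists 0, (Rsum predT lam'), lam', q0, q1; split; [|split; [|split]].
- by move=> a; apply: lam0.
- by rewrite Rminus_0_r.
- exact: (noconn_regular (wfS 0%N) e0 e1 erefl el (@chain_noconn _ _ _ wfS ind 0%N)).
- move=> x; rewrite XE; symmetry.
  apply: (coding_S_adic x wfS ind _ prim' es e0 e1 erefl el) => //.
  by rewrite Rminus_0_r.
Qed.
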